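(* Let $\varphi$ be an odd Schwartz function on $\mathbb{R}$, and let $\psi=\widehat{\varphi}$ be the Fourier transform of $\varphi$. Then $$\varphi'(0)+\sum_{n=1}^{\infty}\frac{r_5(n)}{\sqrt{n}}\,\varphi(\sqrt{n}) = -\frac{i}{6\pi}\,\psi'''(0)+\frac{i}{2\pi}\sum_{n=1}^{\infty}\frac{r_5(n)}{n^{3/2}}\Big[\psi(\sqrt{n})-\sqrt{n}\,\psi'(\sqrt{n})\Big].$$
   Context: The Fourier transform on $\mathbb{R}$ is normalized as $\widehat{f}(t)=\int_{\mathbb{R}} f(x)e^{-2\pi i t x}\,dx$. Here $r_5(n)=\#\{m\in\mathbb{Z}^5: |m|^2=n\}$ is the number of representations of $n$ as a sum of $5$ squares of integers (order and signs counted), $|\cdot|$ being the Euclidean norm. Schwartz functions are complex-valued. *)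

(* Defs.v *)
From HB Require Import structures.
From mathcomp Require Import all_boot all_order all_algebra.
From mathcomp Require Import finmap.
From mathcomp Require Import all_classical all_reals all_analysis.
From mathcomp Require Import complex.

Set Implicit Arguments.
Unset Strict Implicit.
Unset Printing Implicit Defensive.

Import Order.TTheory GRing.Theory Num.Theory.
Import numFieldNormedType.Exports.

Local Open Scope classical_set_scope.
Local Open Scope ring_scope.
Local Open Scope complex_scope.

(* MathComp-Analysis puts no normed R-module structure on R[i], so derivatives
   and integrals of functions R -> R[i] are taken on real and imaginary
   parts. *)
Definition cderiven (R : realType) (n : nat) (f : R -> R[i]) (x : R) : R[i] :=
  derive1n n (fun y => complex.Re (f y)) x +i*
  derive1n n (fun y => complex.Im (f y)) x.

Definition csmooth (R : realType) (f : R -> R[i]) : Prop :=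
  forall (n : nat) (x : R),
    derivable (derive1n n (fun y => complex.Re (f y))) x 1 /\
    derivable (derive1n n (fun y => complex.Im (f y))) x 1.

Definition schwartz (R : realType) (f : R -> R[i]) : Prop :=
  csmooth f /\
  forall k n : nat, exists M : R, forall x : R,
    `|x| ^+ k * Normc.normc (cderiven n f x) <= M.

Definition cintegral (R : realType) (f : R -> R[i]) : R[i] :=
  (\int[@lebesgue_measure R]_x complex.Re (f x)) +i*
  (\int[@lebesgue_measure R]_x complex.Im (f x)).

Definition expi (R : realType) (x : R) : R[i] := cos x +i* sin x.

Definition fourier (R : realType) (f : R -> R[i]) (t : R) : R[i] :=
  cintegral (fun x => f x * expi (- (2 * pi * t * x))).

(* [fset_set] is junk on infinite sets, but the set below is always finite. *)
Definition rsq (k n : nat) : nat :=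
  #|` fset_set [set m : 'rV[int]_k | \sum_(i < k) m ord0 i ^+ 2 = n%:Z]|%fset.

Definition csum_from1 (R : realType) (u : nat -> R[i]) (s : R[i]) : Prop :=
  Normc.normc (\sum_(1 <= n < N) u n - s) @[N --> \oo] --> (0 : R).

(* Main.v *)
Require Import Defs.
From HB Require Import structures.
From mathcomp Require Import all_boot all_order all_algebra.
From mathcomp Require Import finmap.
From mathcomp Require Import all_classical all_reals all_analysis.
From mathcomp Require Import measurable_realfun complex.
From mathcomp Require Import ring lra zify.

(** The formula is the Poisson summation formula on Z^5 for the radial function
h (|m|), where phi x = x h x with h even: the left-hand side is the sum of h over
the lattice, and the right-hand side is the sum of its Fourier transform, because
the Fourier transform of a radial function in dimension five is
(psi - xi psi') / xi^3 up to a constant, psi being the transform of phi on the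
line. No integral over R^5 is needed: the formula is proved for Gaussians and
extended by density.

For h = exp (- t x^2) both sides are explicit. The sum of r_5 n exp (- t n) is the
fifth power of the theta function (rsq_generating_function), so the formula is the
fifth power of the inversion formula for theta (theta_inversion). The latter comes
from integrating a Gaussian against Fejer kernels, which concentrate at the
integers (theta_inversion_le).

For the density argument, the terms of the formula must be controlled by a norm in
which Gaussians are dense. Iterating h |-> h' / x gives a sequence of even
functions u 0 = h, u 1, u 2, and so on, all smooth and rapidly decreasing when phi
is an odd Schwartz function (odd_chain). The kernel sin a - a cos a of the radial
transform is, up to a constant, a^(3/2) J_(3/2) (a), and the identity
d/da (a^(k+3/2) J_(k+3/2)) = a a^(k+1/2) J_(k+1/2) turns k integrations by parts
into a bound of the transform of h by the size of u k, with a gain of a power of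
the frequency at each step (chain_bessel_le). Hence the n-th term of the formula
is O (1 / n^2) with a constant proportional to a weighted supremum of u 13
(sphere_term_le).

In such a norm the density is the Weierstrass theorem in the variable
w = exp (- x^2) (gauss_density). A Gaussian is an eigenfunction of h |-> h' / x, so
a combination of Gaussians close to u 13 is the thirteenth function of the chain of
another combination; integrating back from infinity, the latter is close to u 0
(chain_le). Therefore the sum of all terms vanishes (sphere_series_chain). The
statement for complex functions is the real one for both parts: an odd function has
the transform - i times its sine transform (fourier_odd). *)

Import Order.TTheory GRing.Theory Num.Theory.
Import numFieldNormedType.Exports.

Local Open Scope classical_set_scope.
Local Open Scope ring_scope.
Local Open Scope complex_scope.

Set Implicit Arguments.
Unset Strict Implicit.
Unset Printing Implicit Defensive.

(** * Integration over the real line *)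

Section real_line_integral.
Context {R : realType}.
Implicit Types (f g : R -> R) (C x : R).
Let mu := @lebesgue_measure R.

Definition integralT f : R := \int[mu]_x f x.

Definition lorentz x : R := (1 + x ^+ 2)^-1.

Lemma lorentz_gt0 x : 0 < lorentz x.
Proof. by rewrite invr_gt0 ltr_pwDl// sqr_ge0. Qed.

Lemma lorentz_ge0 x : 0 <= lorentz x.
Proof. exact/ltW/lorentz_gt0. Qed.

Lemma lorentz_le1 x : lorentz x <= 1.
Proof. by rewrite invf_le1 ?lerDl ?sqr_ge0// ltr_pwDl// sqr_ge0. Qed.

Lemma lorentzK x : (1 + x ^+ 2) * lorentz x = 1.
Proof. by rewrite divff// gt_eqF// ltr_pwDl// sqr_ge0. Qed.

Lemma lorentzN x : lorentz (- x) = lorentz x.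
Proof. by rewrite /lorentz sqrrN. Qed.

Lemma continuous_lorentz : continuous lorentz.
Proof. exact: continuous_oneDsqrV. Qed.

Lemma lorentz_exp_le x m n : (n <= m)%N -> lorentz x ^+ m <= lorentz x ^+ n.
Proof. by move=> nm; rewrite ler_wiXn2l// ?lorentz_le1// ltW// lorentz_gt0. Qed.

Lemma integrable_lorentz : mu.-integrable setT (EFin \o lorentz).
Proof.
apply/integrableP; split.
  apply/measurable_EFinP; apply: continuous_measurable_fun.
  exact: continuous_lorentz.
under eq_integral => x _ do
  rewrite /= ger0_norm ?(ltW (lorentz_gt0 x))//.
rewrite ge0_symfun_integralT//=.
- rewrite (_ : [set x | _] = `[0, +oo[%classic); last first.
    by apply/seteqP; split => x/=; rewrite in_itv/= andbT.
  by rewrite integral0y_oneDsqr -EFinM ltry.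
- by move=> x; exact/ltW/lorentz_gt0.
- exact: continuous_lorentz.
- by move=> x/=; rewrite lorentzN.
Qed.

(** The integrands in play are continuous and dominated by the Lorentz function;
this class keeps integrability side conditions down to a pointwise bound. *)
Definition tame f := continuous f /\ exists C, forall x, `|f x| <= C * lorentz x.

Lemma tame_integrable f : tame f -> mu.-integrable setT (EFin \o f).
Proof.
move=> [cf [C fC]].
have iC : mu.-integrable setT (EFin \o (fun x => C * lorentz x)).
  have := integrableZl (mu := mu) measurableT C integrable_lorentz.
  by apply: eq_integrable.
apply: (le_integrable _ _ _ iC) => //.
  by apply/measurable_EFinP; exact: continuous_measurable_fun.
move=> x _ /=; rewrite lee_fin (le_trans (fC x))//.
by rewrite ler_norm.
Qed.

Lemma tameZ c f : tame f -> tame (fun x => c * f x).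
Proof.
move=> [cf [C fC]]; split.
  by move=> x; apply: cvgM; [exact: cvg_cst|exact: cf].
exists (`|c| * C) => x; rewrite normrM -mulrA.
by rewrite ler_wpM2l.
Qed.

Lemma tameD f g : tame f -> tame g -> tame (fun x => f x + g x).
Proof.
move=> [cf [C fC]] [cg [D gD]]; split.
  by move=> x; apply: cvgD; [exact: cf|exact: cg].
exists (C + D) => x; rewrite mulrDl (le_trans (ler_normD _ _))//.
by rewrite lerD.
Qed.

Lemma tameN f : tame f -> tame (fun x => - f x).
Proof.
move=> [cf [C fC]]; split; first by move=> x; apply: cvgN; exact: cf.
by exists C => x; rewrite normrN.
Qed.

Lemma tame0 : tame (fun=> 0).
Proof.
by split; [move=> x; exact: cvg_cst|exists 0 => x; rewrite normr0 mul0r].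
Qed.

Lemma tame_sum n (F : nat -> R -> R) : (forall i, tame (F i)) ->
  tame (fun x => \sum_(i < n) F i x).
Proof.
move=> tF; elim: n => [|n ih].
  by have := tame0; congr tame; apply/funext => x; rewrite big_ord0.
have := tameD ih (tF n); congr tame; apply/funext => x.
by rewrite big_ord_recr.
Qed.

Lemma eq_tame f g : f =1 g -> tame f -> tame g.
Proof. by move=> /funext ->. Qed.

Lemma integralTZ c f : tame f ->
  integralT (fun x => c * f x) = c * integralT f.
Proof. by move=> tf; apply: RintegralZl => //; exact: tame_integrable. Qed.

Lemma integralTD f g : tame f -> tame g ->
  integralT (fun x => f x + g x) = integralT f + integralT g.
Proof. by move=> tf tg; apply: RintegralD => //; exact: tame_integrable. Qed.

Lemma integralTN f : tame f -> integralT (fun x => - f x) = - integralT f.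
Proof.
move=> tf; rewrite -mulN1r -integralTZ//.
by apply: eq_Rintegral => x _; rewrite mulN1r.
Qed.

Lemma integralT0 : integralT (fun=> 0) = 0.
Proof. by rewrite /integralT/= Rintegral_cst// mul0r. Qed.

Lemma integralT_sum n (F : nat -> R -> R) : (forall i, tame (F i)) ->
  integralT (fun x => \sum_(i < n) F i x) = \sum_(i < n) integralT (F i).
Proof.
move=> tF; elim: n => [|n ih].
  rewrite big_ord0 -[RHS]integralT0; apply: eq_Rintegral => x _.
  by rewrite big_ord0.
rewrite big_ord_recr/= -ih -integralTD//; last exact: tame_sum.
by apply: eq_Rintegral => x _; rewrite big_ord_recr.
Qed.

Lemma eq_integralT f g : f =1 g -> integralT f = integralT g.
Proof. by move=> /funext ->. Qed.

Lemma integralT_le f g : tame f -> tame g -> (forall x, f x <= g x) ->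
  integralT f <= integralT g.
Proof.
by move=> tf tg fg; apply: le_Rintegral => //; exact: tame_integrable.
Qed.

Lemma tame_lorentz C : tame (fun x => C * lorentz x).
Proof.
apply: tameZ; split; first exact: continuous_lorentz.
by exists 1 => x; rewrite mul1r gtr0_norm// lorentz_gt0.
Qed.

Lemma integralT_norm_le f C : continuous f ->
  (forall x, `|f x| <= C * lorentz x) ->
  `|integralT f| <= C * integralT lorentz.
Proof.
move=> cf fC; have tf : tame f by split => //; exists C.
have tl : tame lorentz.
  by apply: eq_tame (tame_lorentz 1) => x; rewrite mul1r.
rewrite -integralTZ// ler_norml; apply/andP; split.
  rewrite -integralTN; last exact: tameZ.
  apply: integralT_le => // [|x]; first exact/tameN/tameZ.
  by have := fC x; rewrite ler_norml => /andP[].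
apply: integralT_le => // [|x]; first exact: tameZ.
by have := fC x; rewrite ler_norml => /andP[].
Qed.

Lemma integralT_lorentz_ge0 : 0 <= integralT lorentz.
Proof. by apply: Rintegral_ge0 => x _; exact/ltW/lorentz_gt0. Qed.

(** Dominated convergence for the truncations of f. This is how integrals over
the line are reached from the fundamental theorem of calculus. *)
Lemma cvg_integral_itv f : tame f ->
  \int[mu]_(x in `[- n%:R, n%:R]) f x @[n --> \oo] --> integralT f.
Proof.
move=> tf; have If := tame_integrable tf.
pose g n := (f \_ `[- n%:R, n%:R]).
have mf : measurable_fun setT f.
  by apply: continuous_measurable_fun; case: tf.
have mg n : measurable_fun setT (EFin \o g n).
  apply/measurable_EFinP; apply/(measurable_restrictT f) => //.
  exact: measurable_funTS.
have [] := @dominated_convergence _ _ _ mu _ measurableT (fun n => EFin \o g n)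
  (EFin \o f) (fun x => `|f x|%:E) mg.
- exact/measurable_EFinP.
- apply: aeW => x _ /=; apply: cvg_near_cst.
  near=> n; rewrite /g patchE mem_set//= in_itv/=.
  rewrite -ler_norml; near: n.
  exact: nbhs_infty_ger.
- by have := integrable_abse If; apply: eq_integrable.
- apply: aeW => x n _ /=; rewrite /g patchE lee_fin.
  by case: ifP => // _; rewrite normr0.
move=> _ _; rewrite -[X in _ --> X]fineK; last exact: integrable_fin_num.
move=> /fine_cvgP[_ h].
rewrite /integralT /Rintegral; apply: cvg_trans h.
apply: near_eq_cvg; apply: nearW => n /=.
rewrite [in RHS]integral_mkcond; congr fine; apply: eq_integral => x _.
by rewrite /g !patchE; case: ifP.
Unshelve. all: end_near. Qed.

Lemma tame_cvg0 f : (exists C, forall x, `|f x| <= C * lorentz x) ->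
  f n%:R @[n --> \oo] --> 0 /\ f (- n%:R) @[n --> \oo] --> 0.
Proof.
move=> [C fC].
have C0 : 0 <= C by rewrite -(pmulr_lge0 _ (lorentz_gt0 0)) (le_trans _ (fC 0)).
have lim : (C * n.+1%:R^-1 : R) @[n --> \oo] --> 0.
  rewrite -[X in _ --> X](mulr0 C); apply: cvgM; first exact: cvg_cst.
  exact: cvg_harmonic.
have key n : C * lorentz n%:R <= C * n.+1%:R^-1.
  apply: ler_wpM2l => //; rewrite lef_pV2 ?posrE ?ltr_pwDl ?sqr_ge0//.
  rewrite -natrX -[1]/(1%:R) -natrD ler_nat add1n ltnS; case: n => // n.
  by rewrite expnS expn1 leq_pmulr.
split; apply: norm_cvg0; apply: (squeeze_cvgr _ (cvg_cst 0) lim);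
  apply: nearW => n; rewrite normr_ge0/= ?normr_id.
  exact: le_trans (fC _) (key n).
by rewrite (le_trans (fC _))// lorentzN.
Qed.

(** The primitive F vanishes at both ends of the line. *)
Lemma integralT_derive (F f : R -> R) : tame f -> (forall x, is_derive x 1 F (f x)) ->
  (exists C, forall x, `|F x| <= C * lorentz x) -> integralT f = 0.
Proof.
move=> tf dF FC; have [F1 F2] := tame_cvg0 FC.
have cF : continuous F.
  move=> x; apply/differentiable_continuous/derivable1_diffP.
  by have := dF x => -[].
have h : \int[mu]_(x in `[- n%:R, n%:R]) f x @[n --> \oo] --> (0 : R).
  have lim : (F n%:R - F (- n%:R)) @[n --> \oo] --> (0 : R).
    by rewrite -[X in _ --> X](subr0 0); apply: cvgB.
  apply: cvg_trans lim; apply: near_eq_cvg; near=> n.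
  have n0 : (- n%:R < n%:R :> R).
    have : (0 < n)%N by near: n; exact: nbhs_infty_gt.
    rewrite -(ltr_nat R) => n0; rewrite (lt_trans _ n0)// oppr_lt0//.
  rewrite /Rintegral (continuous_FTC2 n0 (F := F))//=.
  - by apply: continuous_subspaceT; case: tf.
  - split.
    + by move=> x _; have := dF x => -[].
    + by apply: cvg_at_right_filter; exact: cF.
    + by apply: cvg_at_left_filter; exact: cF.
  - by move=> x _; rewrite derive1E; have := dF x => -[].
by have := cvg_unique _ (cvg_integral_itv tf) h; exact.
Unshelve. all: end_near. Qed.

(** Differentiation under the integral sign. The domination is only required
for parameters at distance less than 1 from the given one. *)
Lemma is_derive_integralT (f f' : R -> R -> R) :
  (forall t, tame (f t)) ->
  (forall t x : R, is_derive t (1 : R) (f ^~ x : R -> R) (f' t x)) ->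
  (forall a, exists C, forall t x, `|t - a| < 1 -> `|f' t x| <= C * lorentz x) ->
  forall a : R, is_derive a (1 : R) (fun t : R => integralT (f t)) (integralT (f' a)).
Proof.
move=> tf df bf a; have [C fC] := bf a.
have Ia : `]a - 1, a + 1[%classic a by rewrite /= in_itv/=; apply/andP; split; lra.
have C0 : 0 <= C.
  rewrite -(pmulr_lge0 _ (lorentz_gt0 0)) (le_trans _ (fC a 0 _))//.
  by rewrite subrr normr0.
have dE (t x : R) : derive1 (f ^~ x : R -> R) t = f' t x by rewrite derive1E; have := df t x => -[].
have h1 t : `]a - 1, a + 1[%classic t -> mu.-integrable setT (EFin \o f t).
  by move=> _; exact: tame_integrable.
have h2 t x : `]a - 1, a + 1[%classic t -> setT x -> derivable (f ^~ x) t 1.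
  by move=> _ _; have := df t x => -[].
have h3 x : 0 <= C * lorentz x by rewrite mulr_ge0// ltW// lorentz_gt0.
have h4 : mu.-integrable setT (EFin \o (fun x => C * lorentz x)).
  by apply: tame_integrable; exact: tame_lorentz.
have h5 t x : `]a - 1, a + 1[%classic t -> setT x ->
    `|partial1of2 f t x| <= C * lorentz x.
  rewrite /= in_itv/= => /andP[ta at'] _; rewrite /partial1of2 dE; apply: fC.
  by rewrite ltr_norml; apply/andP; split; lra.
apply: DeriveDef.
  exact: (derivable_under_integral measurableT Ia h1 h2 h3 h4 h5).
rewrite -derive1E.
rewrite (differentiation_under_integral measurableT Ia h1 h2 h3 h4 h5).
by apply: eq_Rintegral => x _; rewrite /partial1of2 dE.
Qed.

End real_line_integral.

(** * Derivatives, growth classes and Gaussians *)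

Section derive_rules.
Context {R : realType}.
Implicit Types (f g : R -> R) (x a b : R).

(** The usual rules, on applied functions of a real variable, so that a derivative
is built as a term and its value is settled by a ring identity. *)
Lemma is_derive_add f g x a b : is_derive x 1 f a -> is_derive x 1 g b ->
  is_derive x 1 (fun y => f y + g y) (a + b).
Proof. exact: is_deriveD. Qed.

Lemma is_derive_opp f x a : is_derive x 1 f a ->
  is_derive x 1 (fun y => - f y) (- a).
Proof. exact: is_deriveN. Qed.

Lemma is_derive_mul f g x a b : is_derive x 1 f a -> is_derive x 1 g b ->
  is_derive x 1 (fun y => f y * g y) (a * g x + f x * b).
Proof.
move=> df dg; have := is_deriveM df dg => h.
by apply: is_derive_eq h _; rewrite /GRing.scale/= addrC mulrC.
Qed.

Lemma is_derive_const c x : is_derive x 1 (fun=> c : R) 0.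
Proof. exact: is_derive_cst. Qed.

Lemma is_derive_var x : is_derive x 1 (fun y => y : R) 1.
Proof. exact: is_derive_id. Qed.

Lemma is_derive_pow n x : is_derive x 1 (fun y => y ^+ n : R) (n%:R * x ^+ n.-1).
Proof.
have h := @is_deriveX R R id n x 1 1 (is_derive_id x 1).
by rewrite exprfctE in h; apply: is_derive_eq h _; rewrite /GRing.scale/= mulr1.
Qed.

Lemma is_derive_chain f g x a b : is_derive (g x) 1 f a -> is_derive x 1 g b ->
  is_derive x 1 (fun y => f (g y)) (a * b).
Proof.
move=> df dg; have h := is_derive1_comp df dg.
by apply: is_derive_eq h _; rewrite mulrC.
Qed.

Lemma is_derive_scale f c x a : is_derive (c * x) 1 f a ->
  is_derive x 1 (fun y => f (c * y)) (c * a).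
Proof.
move=> df; have dg : is_derive x 1 (fun y => c * y : R) c.
  apply: is_derive_eq (is_derive_mul (is_derive_const c x) (is_derive_var x)) _.
  by ring.
by apply: is_derive_eq (is_derive_chain df dg) _; rewrite mulrC.
Qed.

Lemma is_derive_continuous f (f' : R -> R) :
  (forall x, is_derive x 1 f (f' x)) -> continuous f.
Proof.
move=> df x; apply/differentiable_continuous/derivable1_diffP.
by have := df x => -[].
Qed.

Lemma continuous_mul f g : continuous f -> continuous g ->
  continuous (fun x => f x * g x).
Proof. by move=> cf cg x; apply: cvgM; [exact: cf|exact: cg]. Qed.

Lemma continuous_add f g : continuous f -> continuous g ->
  continuous (fun x => f x + g x).
Proof. by move=> cf cg x; apply: cvgD; [exact: cf|exact: cg]. Qed.

Lemma continuous_scale f c : continuous f -> continuous (fun x => f (c * x)).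
Proof.
move=> cf x; apply: continuous_comp; last exact: cf.
by apply: cvgM; [exact: cvg_cst|exact: cvg_id].
Qed.

End derive_rules.

Section growth_classes.
Context {R : realType}.
Implicit Types (f g : R -> R) (C x : R).

(** Rapid functions form an ideal over moderate ones, hence products with
polynomials, sines and cosines stay integrable. Schwartz functions enter the
proof only through sequences of rapid functions. *)
Definition moderate g := continuous g /\
  exists k B, forall x, `|g x| <= B * (1 + x ^+ 2) ^+ k.

Definition rapid f := continuous f /\
  forall m, exists C, forall x, `|f x| <= C * lorentz x ^+ m.

Lemma oneDsqr_ge1 x : 1 <= 1 + x ^+ 2.
Proof. by rewrite lerDl sqr_ge0. Qed.

Lemma lorentzV x m : lorentz x ^+ m = ((1 + x ^+ 2) ^+ m)^-1.
Proof. by rewrite /lorentz exprVn. Qed.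

Lemma moderateM f g : moderate f -> moderate g -> moderate (fun x => f x * g x).
Proof.
move=> [cf [k [B fB]]] [cg [l [D gD]]]; split; first exact: continuous_mul.
exists (k + l)%N, (B * D) => x; rewrite normrM exprD mulrACA.
exact: ler_pM.
Qed.

Lemma moderateD f g : moderate f -> moderate g -> moderate (fun x => f x + g x).
Proof.
move=> [cf [k [B fB]]] [cg [l [D gD]]]; split; first exact: continuous_add.
have B0 : 0 <= B.
  by have := fB 0; rewrite expr0n addr0 expr1n mulr1; exact: le_trans.
have D0 : 0 <= D.
  by have := gD 0; rewrite expr0n addr0 expr1n mulr1; exact: le_trans.
exists (k + l)%N, (B + D) => x; rewrite mulrDl (le_trans (ler_normD _ _))//.
apply: lerD; [apply: le_trans (fB x) _|apply: le_trans (gD x) _];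
  by rewrite ler_wpM2l// ler_weXn2l ?oneDsqr_ge1// ?leq_addr ?leq_addl.
Qed.

Lemma moderate_bounded f B : continuous f -> (forall x, `|f x| <= B) ->
  moderate f.
Proof.
by move=> cf fB; split => //; exists 0, B => x; rewrite expr0 mulr1.
Qed.

Lemma moderate_cst c : moderate (fun=> c).
Proof. by apply: (@moderate_bounded _ `|c|) => // x; exact: cvg_cst. Qed.

Lemma moderate_id : moderate (fun x => x).
Proof.
split; first by move=> x; exact: cvg_id.
exists 1%N, 1 => x; rewrite mul1r expr1 -real_normK ?num_real//.
have := sqr_ge0 (`|x| - 2^-1); have := normr_ge0 x; rewrite !expr2; nra.
Qed.

Lemma moderate_sin c : moderate (fun x => sin (c * x)).
Proof.
apply: (@moderate_bounded _ 1) => [|x]; last exact: sin_max.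
by apply: continuous_scale; exact: continuous_sin.
Qed.

Lemma moderate_cos c : moderate (fun x => cos (c * x)).
Proof.
apply: (@moderate_bounded _ 1) => [|x]; last exact: cos_max.
by apply: continuous_scale; exact: continuous_cos.
Qed.

Lemma rapidM f g : rapid f -> moderate g -> rapid (fun x => f x * g x).
Proof.
move=> [cf fC] [cg [k [B gB]]]; split; first exact: continuous_mul.
move=> m; have [C fmC] := fC (m + k)%N; exists (C * B) => x.
rewrite normrM; apply: le_trans (ler_pM _ _ (fmC x) (gB x)) _ => //.
have e : (1 + x ^+ 2) ^+ k * lorentz x ^+ k = 1 by rewrite -exprMn lorentzK expr1n.
rewrite exprD [leLHS](_ : _ = C * B * lorentz x ^+ m * ((1 + x ^+ 2) ^+ k * lorentz x ^+ k)).
  by rewrite e mulr1.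
by ring.
Qed.

Lemma rapidMl f g : moderate f -> rapid g -> rapid (fun x => f x * g x).
Proof.
move=> mf rg; rewrite (_ : (fun x => _) = (fun x => g x * f x)).
  exact: rapidM.
by apply/funext => x; rewrite mulrC.
Qed.

Lemma rapidZ c f : rapid f -> rapid (fun x => c * f x).
Proof. by move=> rf; apply: rapidMl => //; exact: moderate_cst. Qed.

Lemma rapidD f g : rapid f -> rapid g -> rapid (fun x => f x + g x).
Proof.
move=> [cf fC] [cg gC]; split; first exact: continuous_add.
move=> m; have [C fmC] := fC m; have [D gmD] := gC m; exists (C + D) => x.
by rewrite mulrDl (le_trans (ler_normD _ _))// lerD.
Qed.

Lemma rapid0 : rapid (fun=> 0).
Proof.
by split; [move=> x; exact: cvg_cst|move=> m; exists 0 => x; rewrite normr0 mul0r].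
Qed.

Lemma rapid_sum n (F : nat -> R -> R) : (forall i, rapid (F i)) ->
  rapid (fun x => \sum_(i < n) F i x).
Proof.
move=> rF; elim: n => [|n ih].
  by have := rapid0; congr rapid; apply/funext => x; rewrite big_ord0.
have := rapidD ih (rF n); congr rapid; apply/funext => x.
by rewrite big_ord_recr.
Qed.

Lemma rapid_tame f : rapid f -> tame f.
Proof. by move=> [cf /(_ 1%N)]; split. Qed.

Lemma eq_rapid f g : f =1 g -> rapid f -> rapid g.
Proof. by move=> /funext ->. Qed.

Lemma eq_moderate f g : f =1 g -> moderate f -> moderate g.
Proof. by move=> /funext ->. Qed.

Lemma integralT_derive_rapid (F f : R -> R) :
  rapid F -> rapid f -> (forall x, is_derive x 1 F (f x)) -> integralT f = 0.
Proof.
move=> rF rf dF; apply: integralT_derive dF _; first exact: rapid_tame.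
exact: (rapid_tame rF).2.
Qed.

(** There is no boundary term, because F decays faster than G grows. *)
Lemma integralT_parts (F f G g : R -> R) :
  rapid F -> rapid f -> moderate G -> moderate g ->
  (forall x, is_derive x 1 F (f x)) -> (forall x, is_derive x 1 G (g x)) ->
  integralT (fun x => f x * G x) = - integralT (fun x => F x * g x).
Proof.
move=> rF rf mG mg dF dG; apply/eqP; rewrite -addr_eq0; apply/eqP.
rewrite -integralTD; [|exact/rapid_tame/rapidM..].
apply: (@integralT_derive_rapid (fun x => F x * G x)).
- exact: rapidM.
- by apply: rapidD; exact: rapidM.
- by move=> x; exact: is_derive_mul.
Qed.

End growth_classes.

Section gaussian.
Context {R : realType}.
Implicit Types (t c x : R).

Definition gauss t x : R := expR (- (t * x ^+ 2)).

Lemma gauss_gt0 t x : 0 < gauss t x.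
Proof. exact: expR_gt0. Qed.

Lemma gaussN t x : gauss t (- x) = gauss t x.
Proof. by rewrite /gauss sqrrN. Qed.

Lemma is_derive_gauss t x :
  is_derive x 1 (gauss t) (- (2 * t * x) * gauss t x).
Proof.
have h : is_derive x 1 (fun y => - (t * y ^+ 2) : R) (- (t * (2 * x))).
  apply: is_derive_opp.
  apply: is_derive_eq (is_derive_mul (is_derive_const t x) (is_derive_pow 2 x)) _.
  by rewrite expr1; ring.
apply: is_derive_eq (is_derive_chain (is_derive_expR _) h) _.
by rewrite /gauss; ring.
Qed.

Lemma continuous_gauss t : continuous (gauss t).
Proof. exact: is_derive_continuous (is_derive_gauss t). Qed.

Lemma expRge_pow (y : R) m : 0 <= y -> (1 + y / m.+1%:R) ^+ m.+1 <= expR y.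
Proof.
move=> y0; have -> : expR y = expR (y / m.+1%:R) ^+ m.+1.
  by rewrite -expRM_natl mulrC divfK// pnatr_eq0.
 apply: lerXn2r; rewrite ?nnegrE ?expR_ge0//.
  by rewrite addr_ge0// divr_ge0.
exact: expR_ge1Dx.
Qed.

(** From exp y >= (1 + y / (m + 1)) ^ (m + 1) with y = t x ^ 2. *)
Lemma rapid_gauss t : 0 < t -> rapid (gauss t).
Proof.
move=> t0; split; first exact: continuous_gauss.
move=> m; pose C := 1 + m.+1%:R / t; exists (C ^+ m.+1) => x.
have C0 : 0 <= C by rewrite addr_ge0// divr_ge0// ltW.
apply: (@le_trans _ _ (C ^+ m.+1 * lorentz x ^+ m.+1)); last first.
  by rewrite ler_wpM2l ?exprn_ge0// lorentz_exp_le.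
rewrite ger0_norm ?expR_ge0// lorentzV ler_pdivlMr; last first.
  by rewrite exprn_gt0// (lt_le_trans _ (oneDsqr_ge1 x)).
have y0 : 0 <= t * x ^+ 2 by rewrite mulr_ge0 ?sqr_ge0// ltW.
apply: (@le_trans _ _ (gauss t x * (C ^+ m.+1 * expR (t * x ^+ 2)))); last first.
  by rewrite mulrCA /gauss -expRD addNr expR0 mulr1.
rewrite ler_wpM2l ?expR_ge0//.
apply: le_trans (ler_wpM2l _ (expRge_pow m y0)); last by rewrite exprn_ge0.
rewrite -exprMn; apply: lerXn2r; rewrite ?nnegrE.
- by rewrite addr_ge0// sqr_ge0.
- by rewrite mulr_ge0// addr_ge0// divr_ge0.
- rewrite /C mulrDl mul1r mulrDr mulr1.
  have -> : m.+1%:R / t * (t * x ^+ 2 / m.+1%:R) = x ^+ 2.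
    have : m.+1%:R != 0 :> R by rewrite pnatr_eq0.
    by move: m.+1%:R => z z0; field; rewrite z0 gt_eqF.
  have h1 : 0 <= m.+1%:R / t by rewrite divr_ge0// ltW.
  have h2 : 0 <= t * x ^+ 2 / m.+1%:R by rewrite divr_ge0.
  have := sqr_ge0 x; move: h1 h2; move: (m.+1%:R / t) (t * x ^+ 2 / m.+1%:R) => a b.
  by lra.
Qed.

(** The normalization of the density of the normal law of variance 1 / (2 t). *)
Lemma integralT_gauss_scaled t : 0 < t -> integralT (gauss t) = Num.sqrt (pi / t).
Proof.
move=> t0; have t20 : 0 < (2 * t)^-1 by rewrite invr_gt0 mulr_gt0.
pose s := Num.sqrt (2 * t)^-1.
have s0 : s != 0 by rewrite sqrtr_eq0 -ltNge.
have s2 : s ^+ 2 = (2 * t)^-1 by rewrite sqr_sqrtr// ltW.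
have peak : normal_peak s = (Num.sqrt (pi / t))^-1.
  rewrite /normal_peak s2; congr (Num.sqrt _)^-1.
  by rewrite -mulr_natr; field; rewrite gt_eqF.
have p0 : 0 < Num.sqrt (pi / t) by rewrite sqrtr_gt0 divr_gt0// pi_gt0.
have : integralT (normal_pdf 0 s) = 1.
  by rewrite /integralT /Rintegral integral_normal_pdf.
have -> : normal_pdf 0 s = (fun x => (Num.sqrt (pi / t))^-1 * gauss t x).
  apply/funext => x; rewrite normal_pdfE// peak; congr (_ * _).
  rewrite /normal_fun subr0 s2 /gauss; congr expR.
  by rewrite -mulr_natr; field; rewrite gt_eqF.
rewrite integralTZ; last exact/rapid_tame/rapid_gauss.
by move=> /(canRL (mulKf _)) ->; rewrite ?invrK ?mulr1// invr_eq0 gt_eqF.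
Qed.

Definition gauss_cos t c := integralT (fun x => gauss t x * cos (c * x)).

(** Integration by parts, x exp (- t x ^ 2) being a derivative. *)
Lemma integralT_xgauss_sin t c : 0 < t ->
  integralT (fun x => x * gauss t x * sin (c * x)) = c / (2 * t) * gauss_cos t c.
Proof.
move=> t0; have t20 : 2 * t != 0 by rewrite gt_eqF// mulr_gt0.
have rx : rapid (fun x => x * gauss t x).
  by apply: rapidMl (rapid_gauss t0); exact: moderate_id.
have dg x : is_derive x 1 (gauss t) (- (2 * t) * (x * gauss t x)).
  by apply: is_derive_eq (is_derive_gauss t x) _; ring.
have ds x : is_derive x 1 (fun y => sin (c * y)) (c * cos (c * x)).
  exact: is_derive_scale (is_derive_sin _).
have h := integralT_parts (rapid_gauss t0) (rapidZ _ rx) (moderate_sin c)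
  (moderateM (moderate_cst c) (moderate_cos c)) dg ds.
have e1 : integralT (fun x => gauss t x * (c * cos (c * x))) = c * gauss_cos t c.
  rewrite -integralTZ; last first.
    by apply/rapid_tame/rapidM; [exact: rapid_gauss|exact: moderate_cos].
  by apply: eq_integralT => x; rewrite mulrCA.
have e2 : integralT (fun x => - (2 * t) * (x * gauss t x) * sin (c * x)) =
    - (2 * t) * integralT (fun x => x * gauss t x * sin (c * x)).
  rewrite -integralTZ; last by apply/rapid_tame/rapidM => //; exact: moderate_sin.
  by apply: eq_integralT => x; rewrite mulrA.
apply: (@mulfI _ (- (2 * t))); first by rewrite oppr_eq0.
by rewrite -e2 h e1; field; rewrite gt_eqF.
Qed.

(** The Fourier transform of the Gaussian solves G' = - (c / 2 t) G, by
integralT_xgauss_sin. *)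
Lemma gauss_cosE t c : 0 < t ->
  gauss_cos t c = Num.sqrt (pi / t) * expR (- (c ^+ 2 / (4 * t))).
Proof.
move=> t0.
have dG (a : R) : is_derive a 1 (gauss_cos t) (- (a / (2 * t)) * gauss_cos t a).
  have h := @is_derive_integralT R (fun c x => gauss t x * cos (c * x))
    (fun c x => - (x * gauss t x * sin (c * x))).
  apply: (is_derive_eq (h _ _ _ a)).
  - by move=> b; apply/rapid_tame/rapidM; [exact: rapid_gauss|exact: moderate_cos].
  - move=> b x; have d := @is_derive_scale R cos x b _ (is_derive_cos _).
    have e := is_derive_mul (is_derive_const (gauss t x) b) d.
    rewrite (_ : (fun s : R => _) = (fun s => gauss t x * cos (x * s))); last first.
      by apply/funext => s; rewrite [x * s]mulrC.
    by apply: is_derive_eq e _; rewrite [x * b]mulrC; ring.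
  - move=> b; have rx : rapid (fun x => x * gauss t x).
      by apply: rapidMl (rapid_gauss t0); exact: moderate_id.
    have [C xC] := rx.2 1%N; exists C => s x _.
    rewrite normrN normrM; apply: le_trans (xC x).
    by rewrite ler_piMr// sin_max.
  - rewrite integralTN ?integralT_xgauss_sin//; first by rewrite mulNr.
    apply/rapid_tame/rapidM; last exact: moderate_sin.
    by apply: rapidMl (rapid_gauss t0); exact: moderate_id.
pose E a := expR (a ^+ 2 / (4 * t)).
have dE (a : R) : is_derive a 1 E (a / (2 * t) * E a).
  have h : is_derive a 1 (fun y => y ^+ 2 / (4 * t) : R) (a / (2 * t)).
    have := is_derive_mul (is_derive_pow 2 a) (is_derive_const (4 * t)^-1 a).
    move=> e; apply: is_derive_eq e _; rewrite expr1.
    by field; rewrite gt_eqF.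
  apply: is_derive_eq (is_derive_chain (is_derive_expR _) h) _.
  by rewrite mulrC.
have cst a : gauss_cos t a * E a = gauss_cos t 0 * E 0.
  apply: (@is_derive_0_is_cst _ (fun a => gauss_cos t a * E a)) => x.
  by apply: is_derive_eq (is_derive_mul (dG x) (dE x)) _; ring.
have := cst c; rewrite {2}/E expr0n/= mul0r expR0 mulr1.
have -> : gauss_cos t 0 = Num.sqrt (pi / t).
  rewrite -integralT_gauss_scaled//; apply: eq_integralT => x.
  by rewrite mul0r cos0 mulr1.
move=> <-; rewrite -mulrA /E -expRD subrr expR0 mulr1//.
Qed.

End gaussian.

(** * The inversion formula for the theta function *)

Section fejer_kernel.
Context {R : realType}.
Implicit Types (x a b : R).

Definition dirichlet n x : R :=
  1 + \sum_(k < n) 2 * cos (2 * pi * k.+1%:R * x).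

(** Without the usual factor 1 / N. *)
Definition fejer N x : R := \sum_(n < N) dirichlet n x.

Lemma dirichletS n x :
  dirichlet n.+1 x = dirichlet n x + 2 * cos (2 * pi * n.+1%:R * x).
Proof. by rewrite /dirichlet big_ord_recr/= addrA. Qed.

Lemma fejerS N x : fejer N.+1 x = fejer N x + dirichlet N x.
Proof. by rewrite /fejer big_ord_recr. Qed.

Lemma onemcos_dirichlet n x : (1 - cos (2 * pi * x)) * dirichlet n x =
  cos (2 * pi * n%:R * x) - cos (2 * pi * n.+1%:R * x).
Proof.
elim: n => [|n ih].
  by rewrite /dirichlet big_ord0 addr0 !mulr1 mulr0 mul0r cos0.
rewrite dirichletS mulrDr ih.
set c := 2 * pi * n.+1%:R * x; set b := 2 * pi * x.
have -> : 2 * pi * n%:R * x = c - b by rewrite /c /b -natr1; ring.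
have -> : 2 * pi * n.+2%:R * x = c + b by rewrite /c /b -(natr1 n.+1); ring.
by rewrite cosB cosD; ring.
Qed.

(** Telescoping. This closed form gives both the positivity of the kernel and its
boundedness away from the integers. *)
Lemma onemcos_fejer N x : (1 - cos (2 * pi * x)) * fejer N x =
  1 - cos (2 * pi * N%:R * x).
Proof.
elim: N => [|N ih].
  by rewrite /fejer big_ord0 !mulr0 mul0r cos0 subrr.
by rewrite fejerS mulrDr ih onemcos_dirichlet; ring.
Qed.

Lemma cos_eq1_natmul x n : cos x = 1 -> cos (n%:R * x) = 1.
Proof.
move=> x1; have s0 : sin x = 0 by apply: cos1sin0; rewrite x1 normr1.
suff: cos (n%:R * x) = 1 /\ sin (n%:R * x) = 0 by case.
elim: n => [|n [ihc ihs]]; first by rewrite mul0r cos0 sin0.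
by rewrite -natr1 mulrDl mul1r cosD sinD ihc ihs x1 s0; split; ring.
Qed.

Lemma fejer_ge0 N x : 0 <= fejer N x.
Proof.
(* At the integers the closed form says nothing; there all cosines are 1. *)
have [x1|x1] := eqVneq (cos (2 * pi * x)) 1.
  apply: sumr_ge0 => n _; rewrite addr_ge0// sumr_ge0// => k _.
  have -> : 2 * pi * k.+1%:R * x = k.+1%:R * (2 * pi * x) by ring.
  by rewrite cos_eq1_natmul// mulr1.
have lt1 : 0 < 1 - cos (2 * pi * x) by rewrite subr_gt0 lt_neqAle x1 cos_le1.
by rewrite -(pmulr_rge0 _ lt1) onemcos_fejer subr_ge0 cos_le1.
Qed.

Lemma moderate_dirichlet n : moderate (dirichlet n).
Proof.
elim: n => [|n ih].
  by apply: eq_moderate (moderate_cst 1) => x; rewrite /dirichlet big_ord0 addr0.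
apply: (@eq_moderate _ (fun x => dirichlet n x + 2 * cos (2 * pi * n.+1%:R * x))).
  by move=> x; rewrite dirichletS.
apply: moderateD => //; apply: moderateM; first exact: moderate_cst.
exact: moderate_cos.
Qed.

Lemma moderate_fejer N : moderate (fejer N).
Proof.
elim: N => [|N ih].
  by apply: eq_moderate (moderate_cst 0) => x; rewrite /fejer big_ord0.
apply: (@eq_moderate _ (fun x => fejer N x + dirichlet N x)).
  by move=> x; rewrite fejerS.
by apply: moderateD => //; exact: moderate_dirichlet.
Qed.

End fejer_kernel.

Section interval_integral.
Context {R : realType}.
Implicit Types (f g : R -> R) (a b c : R).
Let mu := @lebesgue_measure R.

Definition integral_itv f a b : R := \int[mu]_(x in `[a, b]) f x.

Lemma integrable_itv f a b : continuous f ->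
  mu.-integrable `[a, b] (EFin \o f).
Proof.
move=> cf; apply: continuous_compact_integrable; first exact: segment_compact.
exact: continuous_subspaceT.
Qed.

Lemma integral_itv_le f g a b : continuous f -> continuous g ->
  (forall x, a <= x <= b -> f x <= g x) -> integral_itv f a b <= integral_itv g a b.
Proof.
by move=> cf cg fg; apply: le_Rintegral => //; exact: integrable_itv.
Qed.

Lemma integral_itvB f g a b : continuous f -> continuous g ->
  integral_itv (fun x => f x - g x) a b = integral_itv f a b - integral_itv g a b.
Proof. by move=> cf cg; apply: RintegralB => //; exact: integrable_itv. Qed.

Lemma integral_itvD f g a b : continuous f -> continuous g ->
  integral_itv (fun x => f x + g x) a b = integral_itv f a b + integral_itv g a b.
Proof. by move=> cf cg; apply: RintegralD => //; exact: integrable_itv. Qed.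

Lemma integral_itvZ c f a b : continuous f ->
  integral_itv (fun x => c * f x) a b = c * integral_itv f a b.
Proof. by move=> cf; apply: RintegralZl => //; exact: integrable_itv. Qed.

Lemma integral_itv_cst c a b : a <= b ->
  integral_itv (fun=> c) a b = c * (b - a).
Proof.
move=> ab; rewrite /integral_itv Rintegral_cst//= lebesgue_measure_itv/=.
case: ifPn => [_|]; first by rewrite -EFinD.
rewrite lte_fin -leNgt => ba; have -> : a = b by apply/le_anti/andP.
by rewrite subrr.
Qed.

Lemma integral_itv_cos c a : c != 0 -> sin (c * (a + 1)) = sin (c * a) ->
  integral_itv (fun x => cos (c * x)) a (a + 1) = 0.
Proof.
move=> c0 e; pose F x := sin (c * x) / c.
have dF (x : R) : is_derive x 1 F (cos (c * x)).
  have h := is_derive_scale (is_derive_sin (c * x)).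
  apply: is_derive_eq (is_derive_mul h (is_derive_const c^-1 x)) _.
  by rewrite mulr0 addr0; field.
have cF := is_derive_continuous dF.
have aa1 : a < a + 1 by lra.
rewrite /integral_itv /Rintegral (continuous_FTC2 aa1 (F := F))//=.
- by rewrite /F e subrr.
- apply: continuous_subspaceT; apply: continuous_scale; exact: continuous_cos.
- split.
  + by move=> x _; have := dF x => -[].
  + by apply: cvg_at_right_filter; exact: cF.
  + by apply: cvg_at_left_filter; exact: cF.
- by move=> x _; rewrite derive1E; have := dF x => -[].
Qed.

Lemma sin_shift a k : sin (2 * pi * k%:R * (a + 1)) = sin (2 * pi * k%:R * a).
Proof.
have -> : 2 * pi * k%:R * (a + 1) = 2 * pi * k%:R * a + (pi *+ 2) *+ k.
  by rewrite -[_ *+ k]mulr_natr -[pi *+ 2]mulr_natr; ring.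
by apply: periodicn => x; exact: sinD2pi.
Qed.

Lemma integral_dirichlet n a : integral_itv (dirichlet n) a (a + 1) = 1.
Proof.
elim: n => [|n ih].
  rewrite (_ : dirichlet 0 = cst 1); last first.
    by apply/funext => x; rewrite /dirichlet big_ord0 addr0.
  by rewrite integral_itv_cst ?lerDl// mul1r addrC addKr.
have cc : continuous (fun x : R => cos (2 * pi * n.+1%:R * x)).
  by apply: continuous_scale; exact: continuous_cos.
rewrite (_ : dirichlet _ =
    (fun x => dirichlet n x + 2 * cos (2 * pi * n.+1%:R * x))); last first.
  by apply/funext => x; rewrite dirichletS.
have [cd _] := @moderate_dirichlet R n.
rewrite integral_itvD// ?ih ?integral_itvZ// ?integral_itv_cos ?mulr0 ?addr0//.
- by rewrite !mulf_neq0// ?pnatr_eq0// gt_eqF// pi_gt0.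
- exact: sin_shift.
- by apply: continuous_mul => //; move=> x; exact: cvg_cst.
Qed.

Lemma integral_fejer N a : integral_itv (fejer N) a (a + 1) = N%:R.
Proof.
elim: N => [|N ih].
  rewrite (_ : fejer 0 = cst 0); last first.
    by apply/funext => x; rewrite /fejer big_ord0.
  by rewrite integral_itv_cst ?lerDl// mul0r.
rewrite (_ : fejer _ = (fun x => fejer N x + dirichlet N x)); last first.
  by apply/funext => x; rewrite fejerS.
have [cd _] := @moderate_dirichlet R N; have [cf _] := @moderate_fejer R N.
by rewrite integral_itvD// ih integral_dirichlet natr1.
Qed.

Lemma integral_itv_chain f a n : continuous f ->
  integral_itv f a (a + n%:R) =
  \sum_(i < n) integral_itv f (a + i%:R) (a + i%:R + 1).
Proof.
move=> cf; elim: n => [|n ih].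
  by rewrite big_ord0 addr0 /integral_itv set_itv1 Rintegral_set1.
rewrite big_ord_recr/= -ih; apply/eqP; rewrite addrC -subr_eq; apply/eqP.
rewrite /integral_itv.
rewrite (@Rintegral_itvB _ f (BLeft a) (BRight (a + n.+1%:R)) (a + n%:R)).
- rewrite Rintegral_itv_obnd_cbnd; last first.
    apply: integrableS (integrable_itv (a + n%:R) (a + n.+1%:R) cf) => //.
    exact: subset_itv_oc_cc.
  by rewrite -natr1 addrA.
- exact: integrable_itv.
- by rewrite bnd_simp lerDl.
- by rewrite bnd_simp lerD2l ler_nat.
Qed.

Lemma integral_itv_le_integralT f a b : tame f -> (forall x, 0 <= f x) ->
  integral_itv f a b <= integralT f.
Proof.
move=> tf f0; rewrite /integral_itv Rintegral_mkcond.
apply: le_Rintegral => //.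
- rewrite (_ : EFin \o _ = (EFin \o f) \_ `[a, b]); last first.
    by apply/funext => x; rewrite /= !patchE; case: ifP.
  by apply/(integrable_mkcond _ _).1 => //; exact: integrable_itv tf.1.
- exact: tame_integrable.
- by move=> x _; rewrite patchE; case: ifP.
Qed.

End interval_integral.

Section theta.
Context {R : realType}.
Implicit Types (t : R).

(** Near an integer m the kernel behaves like N times a point mass: where
x is away from m, the defect is absorbed by 1 - cos (2 pi x), whose
product with the kernel stays bounded. *)
Lemma fejer_concentration (g : R -> R) (i M : nat) (eta : R) :
  continuous g -> (forall x, 0 <= g x) -> 0 < eta ->
  exists K, forall N,
    (g (i%:R - M%:R) - eta) * N%:R - K <=
    integral_itv (fun x => g x * fejer N x)
      (i%:R - M%:R - 2^-1) (i%:R - M%:R - 2^-1 + 1).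
Proof.
move=> cg g0 eta0; set m := i%:R - M%:R.
have [/= d d0 dP] := (@cvgrPdist_lt _ _ _ _ _ g (g m)).1 (cg m) _ eta0.
(* e is below the modulus d of continuity and at most 1/4, so that 2 pi e is in
   the range where the cosine decreases. *)
pose e := Num.min d (2^-1) / 2.
have e0 : 0 < e by rewrite divr_gt0// lt_min d0/= invr_gt0.
have ed : e < d.
  by rewrite /e ltr_pdivrMr// gt_min; apply/orP; left; lra.
have e4 : e <= 4^-1.
  rewrite /e ler_pdivrMr//; have : Num.min d 2^-1 <= 2^-1 by rewrite ge_min lexx orbT.
  by lra.
clearbody e; have pi0 := @pi_gt0 R.
have c1 : cos (2 * pi * e) < 1.
  rewrite -[ltRHS]cos0 ltr_cos ?in_itv/=.
  - by rewrite !mulr_gt0.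
  - by rewrite lexx ltW.
  - apply/andP; split; first by rewrite !mulr_ge0// ltW.
    by nra.
pose D := 1 - cos (2 * pi * e); have D0 : 0 < D by rewrite subr_gt0.
pose K := g m / D; have K0 : 0 <= K by rewrite divr_ge0// ltW.
exists (2 * K) => N.
have [cF _] := @moderate_fejer R N.
have cc : continuous (fun x : R => cos (2 * pi * N%:R * x)).
  by apply: continuous_scale; exact: continuous_cos.
have cK (k : R) : continuous (fun _ : R => k) by move=> x; exact: cvg_cst.
pose l x := (g m - eta) * fejer N x - K * (1 - cos (2 * pi * N%:R * x)).
have c1c : continuous (fun x : R => 1 - cos (2 * pi * N%:R * x)).
  by move=> x; apply: cvgB; [exact: cvg_cst|exact: cc].
have cl1 : continuous (fun x => (g m - eta) * fejer N x) by exact: continuous_mul.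
have cl2 : continuous (fun x => K * (1 - cos (2 * pi * N%:R * x))).
  exact: continuous_mul.
apply: (@le_trans _ _ (integral_itv l (m - 2^-1) (m - 2^-1 + 1))).
  rewrite integral_itvB// !integral_itvZ// integral_fejer lerB//.
  rewrite [leRHS]mulrC ler_wpM2l//.
  apply: (@le_trans _ _ (integral_itv (fun=> 2) (m - 2^-1) (m - 2^-1 + 1))).
    apply: integral_itv_le => // x _.
    by have := cos_geN1 (2 * pi * N%:R * x); lra.
  by rewrite integral_itv_cst ?lerDl//; lra.
apply: integral_itv_le.
- by move=> x; apply: cvgB; [exact: cl1|exact: cl2].
- exact: continuous_mul.
move=> x /andP[x1 x2]; rewrite /l -onemcos_fejer mulrA -mulrBl.
apply: ler_wpM2r; first exact: fejer_ge0.
have Kc : 0 <= K * (1 - cos (2 * pi * x)).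
  by rewrite mulr_ge0// subr_ge0 cos_le1.
have [xm|xm] := ltP `|x - m| d.
  have := dP x; rewrite /= distrC => /(_ xm); rewrite ltr_norml => /andP[_].
  by move=> h; lra.
suff : D <= 1 - cos (2 * pi * x).
  move=> h; have : K * D <= K * (1 - cos (2 * pi * x)) by rewrite ler_wpM2l.
  rewrite {1}/K divfK ?gt_eqF// => h1.
  by have := g0 x; lra.
rewrite lerD2l lerN2.
have -> : cos (2 * pi * x) = cos (2 * pi * `|x - m|).
  have -> : 2 * pi * `|x - m| = `|2 * pi * (x - m)|.
    by rewrite normrM gtr0_norm// mulr_gt0.
  rewrite cos_norm.
  rewrite -(@periodicn _ _ cos (pi *+ 2) _ M (2 * pi * x)) => [|y]; last exact: cosD2pi.
  rewrite -(@periodicn _ _ cos (pi *+ 2) _ i (2 * pi * (x - m))) => [|y]; last exact: cosD2pi.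
  by congr cos; rewrite /m -[_ *+ M]mulr_natr -[_ *+ i]mulr_natr -[pi *+ 2]mulr_natr; ring.
have xm2 : `|x - m| <= 2^-1 by rewrite ler_norml; apply/andP; split; lra.
rewrite leNgt ltr_cos ?in_itv/=.
- by rewrite -leNgt ler_pM2l ?mulr_gt0//; lra.
- apply/andP; split; first by rewrite !mulr_ge0// ltW.
  by nra.
- apply/andP; split; first by rewrite !mulr_ge0// ltW.
  by nra.
Qed.

Definition theta_partial t n : R := 1 + \sum_(k < n) 2 * gauss t k.+1%:R.

Lemma theta_partialS t n :
  theta_partial t n.+1 = theta_partial t n + 2 * gauss t n.+1%:R.
Proof. by rewrite /theta_partial big_ord_recr/= addrA. Qed.

Lemma is_cvg_theta t : 0 < t -> cvgn (theta_partial t).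
Proof.
move=> t0; pose q := expR (- t).
have q1 : `|q| < 1 by rewrite ger0_norm ?expR_ge0// expR_lt1 oppr_lt0.
have h : cvgn (series (fun k => gauss t k.+1%:R)).
  apply: (series_le_cvg (v_ := geometric q q)).
  - by move=> n; exact: expR_ge0.
  - by move=> n; rewrite mulr_ge0 ?exprn_ge0 ?expR_ge0.
  - move=> n /=; rewrite -exprS /q -expRM_natl ler_expR mulrN lerN2.
    rewrite mulrC ler_wpM2l ?(ltW t0)// -natrX ler_nat.
    by rewrite expnS expn1 leq_pmulr.
  - by apply: cvgP; exact: cvg_geometric_series.
have -> : theta_partial t = (fun n => 1 + 2 * series (fun k => gauss t k.+1%:R) n).
  by apply/funext => n; rewrite /theta_partial /series/= big_mkord mulr_sumr.
by apply: is_cvgD; [exact: is_cvg_cst|apply: is_cvgM => //; exact: is_cvg_cst].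
Qed.

(** The sum of gauss t over all integers, folded at 0. *)
Definition theta t : R := limn (theta_partial t).

Lemma sum_gauss_symmetric t M :
  \sum_(i < M.*2.+1) gauss t (i%:R - M%:R) = theta_partial t M.
Proof.
elim: M => [|M ih].
  by rewrite big_ord1 /theta_partial big_ord0 subrr /gauss expr0n/= mulr0 oppr0 expR0 addr0.
rewrite theta_partialS -ih.
rewrite big_ord_recl big_ord_recr/=.
rewrite (_ : gauss t (0%:R - M.+1%:R) = gauss t M.+1%:R); last by rewrite sub0r gaussN.
rewrite (_ : (bump 0 M.*2.+1)%:R - M.+1%:R = M.+1%:R :> R); last first.
  by rewrite /bump/= add1n -addnn -!natr1 natrD; ring.
rewrite addrCA (_ : 2 * gauss t M.+1%:R = gauss t M.+1%:R + gauss t M.+1%:R).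
  congr (_ + _); apply: eq_bigr => i _.
  by rewrite /bump/= add1n -!natr1; congr gauss; ring.
by ring.
Qed.

(** The kernel is a sum of cosines, and the Fourier transform of the Gaussian of
parameter t is the Gaussian of parameter pi ^ 2 / t at the integers; the result
is, up to the factor N, a Cesaro mean. *)
Lemma integralT_gauss_fejer t N : 0 < t ->
  integralT (fun x => gauss t x * fejer N x) =
  \sum_(n < N) (Num.sqrt (pi / t) * theta_partial (pi ^+ 2 / t) n).
Proof.
move=> t0.
have tD n : tame (fun x => gauss t x * dirichlet n x).
  by apply/rapid_tame/rapidM; [exact: rapid_gauss|exact: moderate_dirichlet].
have tC n : tame (fun x => gauss t x * cos (2 * pi * n%:R * x)).
  by apply/rapid_tame/rapidM; [exact: rapid_gauss|exact: moderate_cos].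
rewrite (eq_integralT (g := fun x => \sum_(n < N) gauss t x * dirichlet n x)); last first.
  by move=> x; rewrite mulr_sumr.
rewrite (integralT_sum _ tD); apply: eq_bigr => -[/= n _] _.
elim: n => [|n ih].
  rewrite (eq_integralT (g := gauss t)) => [|x]; last first.
    by rewrite /dirichlet big_ord0 addr0 mulr1.
  by rewrite integralT_gauss_scaled// /theta_partial big_ord0 addr0 mulr1.
rewrite (eq_integralT (g := fun x => gauss t x * dirichlet n x +
  2 * (gauss t x * cos (2 * pi * n.+1%:R * x)))) => [|x]; last first.
  by rewrite dirichletS; ring.
rewrite integralTD//; last exact: tameZ.
rewrite ih integralTZ// -[integralT _]/(gauss_cos t _) gauss_cosE//.
rewrite theta_partialS [RHS]mulrDr; congr (_ + _).
rewrite [RHS]mulrCA; congr (_ * _); congr (_ * _); congr expR; congr (- _).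
by field; rewrite gt_eqF.
Qed.

(** Integrate the Gaussian against the Fejer kernel. The integral over the line
tends, after division by N, to the right-hand side; it is at least the integral
over finitely many unit intervals around integers, and there the kernel
concentrates. *)
Lemma theta_inversion_le t : 0 < t ->
  theta t <= Num.sqrt (pi / t) * theta (pi ^+ 2 / t).
Proof.
move=> t0; have s0 : 0 < pi ^+ 2 / t by rewrite divr_gt0// exprn_gt0// pi_gt0.
set A := Num.sqrt _ * _.
have rG := @rapid_gauss R _ t0.
have cesA : (N.+1%:R^-1 * integralT (fun x => gauss t x * fejer N.+1 x))
    @[N --> \oo] --> A.
  have h : (Num.sqrt (pi / t) * theta_partial (pi ^+ 2 / t) n) @[n --> \oo] --> A.
    by apply: cvgM; [exact: cvg_cst|exact: is_cvg_theta].
  have := cesaro h; rewrite /arithmetic_mean; apply: cvg_trans.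
  apply: near_eq_cvg; apply: nearW => N /=.
  by rewrite integralT_gauss_fejer// /series/= big_mkord.
apply: limr_le; first exact: is_cvg_theta.
apply: nearW => M; rewrite -sum_gauss_symmetric.
set L := M.*2.+1; apply/ler_addgt0Pl => eta eta0.
(* an error eta / L for each of the L intervals *)
pose d := eta / L%:R; have d0 : 0 < d by rewrite divr_gt0// ltr0n.
have L0 : L%:R != 0 :> R by rewrite pnatr_eq0.
have [K KP] := choice (fun i : nat => @fejer_concentration (gauss t) i M d
  (@continuous_gauss _ t) (fun x => ltW (gauss_gt0 t x)) d0).
pose S := \sum_(i < L) gauss t (i%:R - M%:R).
pose C := \sum_(i < L) K i.
have low N : (S - eta) * N%:R - C <= integralT (fun x => gauss t x * fejer N x).
  have tF : tame (fun x => gauss t x * fejer N x).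
    by apply/rapid_tame/rapidM => //; exact: moderate_fejer.
  apply: le_trans (integral_itv_le_integralT (- M%:R - 2^-1)
    (- M%:R - 2^-1 + L%:R) tF _); last first.
    by move=> x; rewrite mulr_ge0 ?fejer_ge0// ltW// gauss_gt0.
  rewrite integral_itv_chain; last by case: tF.
  have -> : (S - eta) * N%:R - C =
      \sum_(i < L) ((gauss t (i%:R - M%:R) - d) * N%:R - K i).
    rewrite sumrB -mulr_suml sumrB sumr_const card_ord -[d *+ L]mulr_natr.
    by rewrite /d divfK.
  apply: ler_sum => i _; have := KP i N.
  by rewrite (_ : - M%:R - 2^-1 + i%:R = i%:R - M%:R - 2^-1)//; ring.
rewrite -lerBlDl -/S.
have lim : ((S - eta) - C / N.+1%:R) @[N --> \oo] --> S - eta.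
  rewrite -[X in _ --> X]subr0 -[X in _ --> _ - X](mulr0 C).
  by apply: cvgB; [exact: cvg_cst|apply: cvgM; [exact: cvg_cst|exact: cvg_harmonic]].
apply: (ler_cvg_to lim cesA); apply: nearW => N.
by rewrite [leRHS]mulrC ler_pdivlMr// mulrBl divfK ?pnatr_eq0.
Qed.

(** The two Gaussians being Fourier transforms of each other, the inequality at t
and the inequality at pi ^ 2 / t are opposite. *)
Lemma theta_inversion t : 0 < t ->
  theta t = Num.sqrt (pi / t) * theta (pi ^+ 2 / t).
Proof.
move=> t0; have pi0 := @pi_gt0 R.
have s0 : 0 < pi ^+ 2 / t by rewrite divr_gt0// exprn_gt0.
have := theta_inversion_le s0.
have -> : pi ^+ 2 / (pi ^+ 2 / t) = t.
  by move: pi pi0 => p p0; field; rewrite !gt_eqF.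
have -> : pi / (pi ^+ 2 / t) = (pi / t)^-1.
  by move: pi pi0 => p p0; field; rewrite !gt_eqF.
rewrite sqrtrV ?(ltW (divr_gt0 pi0 t0))// => h.
apply: le_anti; rewrite theta_inversion_le//=.
by rewrite -ler_pdivlMl ?sqrtr_gt0 ?divr_gt0.
Qed.

End theta.

(** * Sums of squares and powers of the theta function *)

Section sums_of_squares.
Context {R : realType}.

Definition sphere (k n : nat) : set 'rV[int]_k :=
  [set m : 'rV[int]_k | \sum_(i < k) m ord0 i ^+ 2 = n%:Z].
Arguments sphere : clear implicits.

(** The integer points of the box [-n, n] ^ k, which contains the sphere. *)
Let cube (k n : nat) (f : {ffun 'I_k -> 'I_n.*2.+1}) : 'rV[int]_k :=
  \row_i ((f i : nat)%:Z - n%:Z).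

Let sphere_cube k n : sphere k n `<=` [set @cube k n f | f in setT].
Proof.
move=> m /= mn.
have bnd i : `|m ord0 i| <= n%:Z.
  have : m ord0 i ^+ 2 <= n%:Z.
    rewrite -mn (bigD1 i)//= lerDl sumr_ge0// => j _; exact: sqr_ge0.
  move: (m ord0 i) => z; rewrite expr2 => h.
  by rewrite ler_norml; apply/andP; split; nia.
have rng i : (absz (m ord0 i + n%:Z)%R < n.*2.+1)%N.
  have := bnd i; rewrite ler_norml => /andP[h1 h2].
  by rewrite -addnn; lia.
exists [ffun i => Ordinal (rng i)] => //; apply/rowP => i.
rewrite mxE ffunE/= gez0_abs; first by rewrite addrK.
by have := bnd i; rewrite ler_norml => /andP[h1 _]; rewrite -lerBlDr sub0r.
Qed.

Lemma finite_sphere k n : finite_set (sphere k n).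
Proof.
apply: (sub_finite_set (@sphere_cube k n)); apply: finite_image.
exact: finite_finset.
Qed.

Lemma rsq_le k n : (rsq k n <= n.*2.+1 ^ k)%N.
Proof.
have fin : finite_set [set @cube k n f | f in [set: {ffun 'I_k -> 'I_n.*2.+1}]].
  by apply: finite_image; exact: finite_finset.
have : (fset_set (sphere k n) `<=`
    fset_set [set @cube k n f | f in [set: {ffun 'I_k -> 'I_n.*2.+1}]])%fset.
  rewrite -fset_set_sub//; first exact: sphere_cube.
  exact: finite_sphere.
move=> /fsubset_leq_card /leq_trans; apply.
rewrite fset_set_image; last exact: finite_finset.
apply: leq_trans (leq_imfset_card _ _ _) _.
have u : uniq (enum_finmem (mem_fin (fin_finpred
    (fset_set [set: {ffun 'I_k -> 'I_n.*2.+1}])))) by exact: enum_finmem_uniq.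
rewrite -(card_uniqP u); apply: leq_trans (max_card _) _.
by rewrite card_ffun !card_ord.
Qed.

End sums_of_squares.
Arguments sphere : clear implicits.

Section rsq_generating_function.
Context {R : realType}.
Implicit Types (t : R).
Local Open Scope ereal_scope.

Lemma esumZ (T : choiceType) (A : set T) (c : R) (a : T -> \bar R) : (0 < c)%R ->
  (forall x, 0 <= a x) -> \esum_(x in A) (c%:E * a x) = c%:E * \esum_(x in A) a x.
Proof.
move=> c0 a0; rewrite /esum -ereal_sup_pZl//; congr ereal_sup.
apply/seteqP; split => [_ [X XA <-]|_ [_ [X XA <-] <-]] /=.
  by exists (\sum_(x \in X) a x)%R; [exists X|rewrite ge0_mule_fsumr].
by exists X => //; rewrite ge0_mule_fsumr.
Qed.

Lemma esum_nat_limn (a : nat -> R) (l : R) : (forall n, 0 <= a n)%R ->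
  series a @ \oo --> l -> \esum_(n in [set: nat]) (a n)%:E = l%:E.
Proof.
move=> a0 al; rewrite -nneseries_esumT => [|n]; last by rewrite lee_fin.
have -> : (fun n => \sum_(0 <= i < n) (a i)%:E) = EFin \o series a.
  by apply/funext => n; rewrite /= /series/= sumEFin.
by rewrite EFin_lim; [congr EFin; apply: cvg_lim|apply: cvgP al].
Qed.

(** Split the integers into 0, the positive and the negative ones. *)
Lemma esum_gauss_int t : (0 < t)%R ->
  \esum_(j in [set: int]) (gauss t j%:~R)%:E = (theta t)%:E.
Proof.
move=> t0; have g0 (j : int) : 0 <= (gauss t j%:~R)%:E by rewrite lee_fin ltW ?gauss_gt0.
have sl : series (fun k => gauss t k.+1%:R) @ \oo --> ((theta t - 1) / 2)%R.
  have h := is_cvg_theta t0.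
  have -> : series (fun k => gauss t k.+1%:R) = (fun n => (theta_partial t n - 1) / 2)%R.
    apply/funext => n; rewrite /theta_partial /series/= big_mkord -mulr_sumr.
    by rewrite addrAC subrr add0r mulrC mulKf.
  by apply: cvgM; [apply: cvgB => //|]; exact: cvg_cst.
rewrite (esumID [set 0%R])//= setTI esum_set1// setTI.
rewrite (esumID (range (fun n => Posz n.+1)))//=.
have -> : ~` [set (0 : int)%R] `&` range (fun n => Posz n.+1) = range (fun n => Posz n.+1).
  by apply/seteqP; split => [x []//|_ [n _ <-]]; split => //; exists n.
have -> : ~` [set (0 : int)%R] `&` ~` range (fun n => Posz n.+1) = range Negz.
  apply/seteqP; split => [[[|n]|n] [/= n0 nP]|_ [n _ <-]].
  - by [].
  - by exfalso; apply: nP; exists n.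
  - by exists n.
  - by split => //= -[].
rewrite !esum_image; [|by move=> ? ? _ _ []|by move=> ? ? _ _ []].
rewrite (esum_nat_limn _ sl); last by move=> n; rewrite ltW ?gauss_gt0.
rewrite (eq_esum (b := fun n => (gauss t n.+1%:R)%:E)); last first.
  by move=> n _; rewrite NegzE mulrNz gaussN.
rewrite (esum_nat_limn _ sl); last by move=> n; rewrite ltW ?gauss_gt0.
rewrite /gauss expr0n/= mulr0 oppr0 expR0 -!EFinD; congr EFin.
by lra.
Qed.

(** Induction on the rank, by splitting off the first coordinate. *)
Lemma esum_gauss_row t k : (0 < t)%R ->
  \esum_(m in [set: 'rV[int]_k]) (\prod_(i < k) gauss t (m ord0 i)%:~R)%:E =
  (theta t ^+ k)%:E.
Proof.
move=> t0; elim: k => [|k ih].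
  rewrite (_ : [set: 'rV[int]_0] = [set 0%R]); last first.
    by apply/seteqP; split => // m _ /=; apply/rowP => -[].
  by rewrite esum_set1 ?big_ord0// lee_fin.
pose e (p : int * 'rV[int]_k) : 'rV[int]_(1 + k) := row_mx (const_mx p.1) p.2.
have be : set_bij (setT `*`` (fun=> setT)) [set: 'rV[int]_k.+1] e.
  split => //.
  - move=> [a b] [c d] _ _; rewrite /e/= => h.
    have [/rowP /(_ ord0)] := @eq_row_mx _ 1 1 k _ _ _ _ h.
    by rewrite !mxE /= => -> ->.
  - move=> m _; exists (lsubmx (m : 'rV_(1 + k)) ord0 ord0, rsubmx (m : 'rV_(1 + k))) => //.
    have E : const_mx (lsubmx (m : 'rV_(1 + k)) ord0 ord0) = lsubmx (m : 'rV_(1 + k)).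
      by apply/rowP => i; rewrite !ord1 mxE.
    by rewrite /e/= E; exact: (@hsubmxK _ 1 1 k).
rewrite (reindex_esum _ _ _ _ be).
pose F (j : int) (m : 'rV[int]_k) := (gauss t j%:~R)%:E *
  (\prod_(i < k) gauss t (m ord0 i)%:~R)%:E.
transitivity (\esum_(p in setT `*`` (fun=> setT)) F p.1 p.2).
  apply: eq_esum => -[a b] _ /=.
  have e0 : e (a, b) ord0 (@ord0 k) = a.
    rewrite (_ : @ord0 k = lshift k ord0 :> 'I_(1 + k)) ?row_mxEl ?mxE//.
    exact: val_inj.
  have eS (i : 'I_k) : e (a, b) ord0 (lift (@ord0 k) i) = b ord0 i.
    rewrite (_ : lift (@ord0 k) i = rshift 1 i :> 'I_(1 + k)) ?row_mxEr//.
    exact: val_inj.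
  rewrite /F -EFinM big_ord_recl e0; congr (_ * _)%:E.
  by apply: eq_bigr => i _; rewrite eS.
have p0 (m : 'rV[int]_k) : 0 <= (\prod_(i < k) gauss t (m ord0 i)%:~R)%:E.
  by rewrite lee_fin prodr_ge0// => i _; rewrite ltW ?gauss_gt0.
rewrite -(esum_esum (a := F)); last first.
  by move=> i j _ _; rewrite mule_ge0// lee_fin ltW ?gauss_gt0.
under eq_esum => j _ do rewrite /F esumZ ?gauss_gt0// ih muleC.
have th0 : (0 < theta t)%R.
  rewrite (@lt_le_trans _ _ 1%R)// /theta.
  apply: limr_ge; first exact: is_cvg_theta.
  apply: nearW => n; rewrite /theta_partial lerDl sumr_ge0// => i _.
  by rewrite mulr_ge0// ltW// gauss_gt0.
rewrite esumZ ?exprn_gt0//; last by move=> j; rewrite lee_fin ltW ?gauss_gt0.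
by rewrite esum_gauss_int// -EFinM -exprSr.
Qed.

(** The k-th power of theta is a sum over the lattice of rank k; its terms are
nonnegative, so they can be regrouped along the spheres. *)
Lemma rsq_generating_function t k : (0 < t)%R ->
  (series (fun n => (rsq k n)%:R * expR (- (t * n%:R)) : R) @ \oo --> theta t ^+ k)%R.
Proof.
move=> t0; pose a (n : nat) := ((rsq k n)%:R * expR (- (t * n%:R)))%R : R.
have a0 n : (0 <= a n)%R by rewrite mulr_ge0// expR_ge0.
have p0 (m : 'rV[int]_k) : 0 <= (\prod_(i < k) gauss t (m ord0 i)%:~R)%:E.
  by rewrite lee_fin prodr_ge0// => i _; rewrite ltW ?gauss_gt0.
have sumE : \esum_(n in [set: nat]) (a n)%:E = (theta t ^+ k)%:E.
  rewrite -esum_gauss_row//.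
  have -> : [set: 'rV[int]_k] = \bigcup_(n in [set: nat]) sphere k n.
    apply/seteqP; split => // m _.
    exists (absz (\sum_(i < k) m ord0 i ^+ 2)%R) => //.
    by rewrite /sphere/= gez0_abs// sumr_ge0// => i _; exact: sqr_ge0.
  rewrite esum_bigcupT//; last first.
    by apply/trivIsetP => i j _ _ ij; apply/seteqP; split => // m [/= mi mj];
      move: ij; rewrite -eqz_nat -mi -mj eqxx.
  apply: eq_esum => n _; rewrite esum_fset//; last exact: finite_sphere.
  rewrite fsbig_finite/=; last exact: finite_sphere.
  rewrite (eq_big_seq (fun=> (expR (- (t * n%:R)))%:E)); last first.
    move=> m; rewrite in_fset_set; last exact: finite_sphere.
    rewrite inE /sphere/= => mn; congr EFin.
    rewrite -(big_morph _ (@expRD R) (@expR0 R)); congr expR.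
    rewrite sumrN -mulr_sumr -[n%:R]/((n%:Z)%:~R) -mn rmorph_sum/=; congr (- (_ * _))%R.
    by apply: eq_bigr => i _; rewrite rmorphXn.
  by rewrite sumEFin big_const_seq count_predT iter_addr_0 /a mulr_natl.
have : EFin \o series a @ \oo --> (theta t ^+ k)%:E.
  rewrite -sumE -nneseries_esumT => [|n]; last by rewrite lee_fin.
  have -> : EFin \o series a = (fun n => \sum_(0 <= i < n) (a i)%:E).
    by apply/funext => n; rewrite /= /series/= sumEFin.
  by apply: is_cvg_nneseries => n _ _; rewrite lee_fin.
by move=> /fine_cvgP[_].
Qed.

End rsq_generating_function.

(** * Bessel functions of half-integral order and chains *)

Section bessel.
Context {R : realType}.
Implicit Types (a x c : R).

(** Up to a constant, a ^ (k + 1/2) J_(k + 1/2) (a), by the three-term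
recurrence in the order. *)
Fixpoint bessel k a : R :=
  match k with
  | 0 => sin a
  | k'.+1 => match k' with
    | 0 => sin a - a * cos a
    | k''.+1 => k''.*2.+3%:R * bessel k' a - a ^+ 2 * bessel k'' a
    end
  end.

Lemma besselSS k a :
  bessel k.+2 a = k.*2.+3%:R * bessel k.+1 a - a ^+ 2 * bessel k a.
Proof. by []. Qed.

Lemma is_derive_bessel k a : is_derive a 1 (bessel k.+1) (a * bessel k a).
Proof.
suff: is_derive a 1 (bessel k.+1) (a * bessel k a) /\
    is_derive a 1 (bessel k.+2) (a * bessel k.+1 a) by case.
elim: k => [|k [ih1 ih2]].
  have d1 : is_derive a 1 (bessel 1) (a * bessel 0 a).
    have h := is_derive_mul (is_derive_var a) (is_derive_cos a).
    apply: is_derive_eq (is_derive_add (is_derive_sin a) (is_derive_opp h)) _.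
    by rewrite /=; ring.
  split => //.
  have h1 := is_derive_mul (is_derive_const 3%:R a) d1.
  have h2 := is_derive_mul (is_derive_pow 2 a) (is_derive_sin a).
  apply: is_derive_eq (is_derive_add h1 (is_derive_opp h2)) _.
  by rewrite /=; ring.
split => //.
have h1 := is_derive_mul (is_derive_const k.+1.*2.+3%:R a) ih2.
have h2 := is_derive_mul (is_derive_pow 2 a) ih1.
apply: is_derive_eq (is_derive_add h1 (is_derive_opp h2)) _.
rewrite besselSS doubleS expr1 (_ : k.*2.+2.+3%:R = k.*2.+3%:R + 2%:R); last first.
  by rewrite -natrD addn2.
move: (bessel k.+1 a) (bessel k a) (k.*2.+3%:R : R) => B b' n.
by ring.
Qed.

(** One power of a per index: this is the loss at each integration by parts. *)
Lemma bessel_le k : exists C, forall a, `|bessel k a| <= C * (1 + `|a|) ^+ k.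
Proof.
suff: (exists C, forall a, `|bessel k a| <= C * (1 + `|a|) ^+ k) /\
  (exists C, forall a, `|bessel k.+1 a| <= C * (1 + `|a|) ^+ k.+1) by case.
elim: k => [|k [[C hC] [D hD]]].
  split; first by exists 1 => a; rewrite mul1r expr0 sin_max.
  exists 1 => a; rewrite mul1r expr1 (le_trans (ler_normB _ _))// lerD ?sin_max//.
  by rewrite normrM ler_piMr// cos_max.
split; first by exists D.
have C0 : 0 <= C by have := hC 0; rewrite normr0 addr0 expr1n mulr1; exact: le_trans.
exists (k.*2.+3%:R * D + C) => a; rewrite besselSS.
have a1 : 1 <= 1 + `|a| by rewrite lerDl.
apply: le_trans (ler_normB _ _) _; rewrite [leRHS]mulrDl !normrM; apply: lerD.
  rewrite ger0_norm// -mulrA ler_wpM2l//; apply: le_trans (hD a) _.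
  rewrite ler_wpM2l//; last by rewrite ler_weXn2l.
  by have := hD 0; rewrite normr0 addr0 expr1n mulr1; exact: le_trans.
rewrite (_ : C * _ = (1 + `|a|) * (1 + `|a|) * (C * (1 + `|a|) ^+ k)); last first.
  by rewrite !exprS; ring.
by rewrite !ler_pM ?mulr_ge0 ?lerDr.
Qed.

Lemma continuous_bessel k : continuous (bessel k).
Proof.
case: k => [|k]; first exact: continuous_sin.
exact: is_derive_continuous (is_derive_bessel k).
Qed.

Lemma oneDnorm_le x : 1 + `|x| <= 2 * (1 + x ^+ 2).
Proof.
rewrite -real_normK ?num_real//; have := normr_ge0 x.
by move: `|x| => y y0; have := sqr_ge0 (y - 4^-1); rewrite !expr2; nra.
Qed.

Lemma moderate_bessel k c : moderate (fun x => bessel k (c * x)).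
Proof.
split; first by apply: continuous_scale; exact: continuous_bessel.
have [C hC] := bessel_le k; exists k, (C * ((1 + `|c|) * 2) ^+ k) => x.
have C0 : 0 <= C by have := hC 0; rewrite normr0 addr0 expr1n mulr1; exact: le_trans.
apply: le_trans (hC _) _; rewrite -mulrA ler_wpM2l// -exprMn.
apply: lerXn2r; rewrite ?nnegrE ?addr_ge0 ?mulr_ge0 ?addr_ge0 ?sqr_ge0//.
rewrite -mulrA; apply: le_trans (ler_wpM2l _ (oneDnorm_le x)); last by rewrite addr_ge0.
by rewrite normrM; have := normr_ge0 c; have := normr_ge0 x; nra.
Qed.

End bessel.

Section chains.
Context {R : realType}.
Implicit Types (u e : nat -> R -> R) (c x : R).

(** The iterates of the operator h |-> h' / x. The same operator lowers the index
of the Bessel functions, whence the integration by parts below. *)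
Definition chain u := [/\ forall j, rapid (u j),
  forall j x, is_derive x 1 (u j) (x * u j.+1 x) & forall j x, u j (- x) = u j x].

Lemma chain_parts u j k c : chain u ->
  integralT (fun x => x * u j.+1 x * bessel k.+1 (c * x)) =
  - c ^+ 2 * integralT (fun x => x * u j x * bessel k (c * x)).
Proof.
move=> [ru du _].
have rx i : rapid (fun x => x * u i x) by apply: rapidMl => //; exact: moderate_id.
have dG x : is_derive x 1 (fun y => bessel k.+1 (c * y)) (c ^+ 2 * (x * bessel k (c * x))).
  apply: is_derive_eq (is_derive_scale (is_derive_bessel k (c * x))) _.
  by rewrite expr2; ring.
have mB : moderate (fun x => c ^+ 2 * (x * bessel k (c * x))).
  apply: moderateM; first exact: moderate_cst.
  by apply: moderateM; [exact: moderate_id|exact: moderate_bessel].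
rewrite (integralT_parts (ru j) (rx j.+1) (moderate_bessel k.+1 c) mB (du j) dG).
rewrite mulNr; congr (- _).
rewrite -integralTZ; last by apply/rapid_tame/rapidM => //; exact: moderate_bessel.
by apply: eq_integralT => x; rewrite mulrCA; congr (_ * _); rewrite mulrCA mulrA.
Qed.

Lemma chain_parts_iter u j c : chain u ->
  integralT (fun x => x * u j x * bessel j.+1 (c * x)) =
  (- c ^+ 2) ^+ j * integralT (fun x => x * u 0%N x * bessel 1 (c * x)).
Proof.
move=> hu; elim: j => [|j ih]; first by rewrite expr0 mul1r.
by rewrite (chain_parts j j.+1 c hu) ih [(- c ^+ 2) ^+ j.+1]exprS mulrA.
Qed.

(** The integral is, up to a constant and a power of the frequency, the Fourier
transform of the radial function u 0 in dimension five; each step in the chain gains two powers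
of the frequency and loses one. *)
Lemma chain_bessel_le j : exists C, forall u A c, chain u -> 1 <= c ->
  (forall x, `|u j x| <= A * lorentz x ^+ j.+3) ->
  `|integralT (fun x => x * u 0%N x * bessel 1 (c * x))| * c ^+ j.*2
    <= C * A * c ^+ j.+1.
Proof.
have [C hC] := @bessel_le R j.+1.
have C0 : 0 <= C by have := hC 0; rewrite normr0 addr0 expr1n mulr1; exact: le_trans.
exists (C * 2 ^+ j.+1 * integralT lorentz) => u A c hu c1 hA.
have c0 : 0 <= c by exact: le_trans c1.
have A0 : 0 <= A.
  by rewrite -(pmulr_lge0 _ (exprn_gt0 j.+3 (lorentz_gt0 0))) (le_trans _ (hA 0)).
have -> : c ^+ j.*2 = `|(- c ^+ 2) ^+ j|.
  by rewrite normrX normrN ger0_norm ?sqr_ge0// -exprM mul2n.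
rewrite mulrC -normrM -chain_parts_iter//.
have [ru _ _] := hu.
have rf : rapid (fun x => x * u j x * bessel j.+1 (c * x)).
  apply: rapidM; last exact: moderate_bessel.
  by apply: rapidMl => //; exact: moderate_id.
rewrite [leRHS](_ : _ = (C * 2 ^+ j.+1 * A * c ^+ j.+1) * integralT lorentz); last by ring.
apply: integralT_norm_le; first by case: rf.
move=> x; rewrite normrM; set L := lorentz x; set y := 1 + x ^+ 2.
have Ly : y * L = 1 by exact: lorentzK.
have y1 : 1 <= y by exact: oneDsqr_ge1.
have L0 : 0 <= L by rewrite ltW ?lorentz_gt0.
have hx : `|x| <= y.
  rewrite /y -real_normK ?num_real//.
  by have := sqr_ge0 (`|x| - 2^-1); have := normr_ge0 x; rewrite !expr2; nra.
have hb : `|bessel j.+1 (c * x)| <= C * (2 * c * y) ^+ j.+1.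
  apply: le_trans (hC _) _; rewrite ler_wpM2l//.
  apply: lerXn2r; rewrite ?nnegrE ?addr_ge0 ?mulr_ge0 ?(le_trans _ y1)//.
  apply: (@le_trans _ _ (c * (1 + `|x|))).
    by rewrite normrM (ger0_norm c0) mulrDr mulr1 lerD2r.
  by rewrite [2 * c]mulrC -mulrA ler_wpM2l// oneDnorm_le.
have hu1 : `|x * u j x| <= y * (A * L ^+ j.+3) by rewrite normrM ler_pM.
apply: le_trans (ler_pM _ _ hu1 hb) _ => //.
rewrite [leLHS](_ : _ = C * 2 ^+ j.+1 * A * c ^+ j.+1 * (L * (y * L) ^+ j.+2)); last first.
  by rewrite !exprMn !exprS; ring.
by rewrite Ly expr1n mulr1.
Qed.

End chains.

Section summation_terms.
Context {R : realType}.
Implicit Types (u f : R -> R) (t : R).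

(** The n-th term of the summation formula, all on one side, for the odd function
x |-> x * u x; sin a - a cos a, which is bessel 1, combines the transform and its
derivative, and the term of index 0 collects the two derivatives at 0. *)
Definition sphere_term u n : R :=
  if n is 0 then u 0 - (6 * pi)^-1 * integralT (fun x => (2 * pi * x) ^+ 3 * (x * u x))
  else (rsq 5 n)%:R * (u (Num.sqrt n%:R) - (2 * pi * Num.sqrt n%:R ^+ 3)^-1 *
    integralT (fun x => x * u x * bessel 1 (2 * pi * Num.sqrt n%:R * x))).

Let tame1 u : rapid u -> tame (fun x => (2 * pi * x) ^+ 3 * (x * u x)).
Proof.
move=> ru; apply: rapid_tame; apply: rapidMl; last by apply: rapidMl => //; exact: moderate_id.
have m1 : moderate (fun x : R => 2 * pi * x).
  by apply: moderateM; [exact: moderate_cst|exact: moderate_id].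
by rewrite (_ : (fun x => _) = fun x => (2 * pi * x) * ((2 * pi * x) * (2 * pi * x)));
  [do 2?apply: moderateM => //|apply/funext => x; ring].
Qed.

Let tame2 u c : rapid u -> tame (fun x => x * u x * bessel 1 (c * x)).
Proof.
move=> ru; apply/rapid_tame/rapidM; last exact: moderate_bessel.
by apply: rapidMl => //; exact: moderate_id.
Qed.

Lemma sphere_termD u f n : rapid u -> rapid f ->
  sphere_term (fun x => u x + f x) n = sphere_term u n + sphere_term f n.
Proof.
move=> ru rf; case: n => [|n]; rewrite /sphere_term.
  rewrite (eq_integralT (g := fun x => (2 * pi * x) ^+ 3 * (x * u x) +
    (2 * pi * x) ^+ 3 * (x * f x))) => [|x]; last by ring.
  by rewrite integralTD; [ring|exact: tame1..].
pose c : R := 2 * pi * Num.sqrt n.+1%:R; rewrite -/c.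
rewrite (eq_integralT (g := fun x => x * u x * bessel 1 (c * x) +
  x * f x * bessel 1 (c * x))) => [|x]; last first.
  by move: (bessel 1 (c * x)) => b; ring.
rewrite integralTD; [|exact: tame2..].
move: (integralT _) (integralT _) (rsq _ _)%:R (_^-1) => I J r d.
by ring.
Qed.

Lemma sphere_termZ k u n : rapid u ->
  sphere_term (fun x => k * u x) n = k * sphere_term u n.
Proof.
move=> ru; case: n => [|n]; rewrite /sphere_term.
  rewrite (eq_integralT (g := fun x => k * ((2 * pi * x) ^+ 3 * (x * u x)))) => [|x];
    last by ring.
  by rewrite integralTZ; [ring|exact: tame1].
pose c : R := 2 * pi * Num.sqrt n.+1%:R; rewrite -/c.
rewrite (eq_integralT (g := fun x => k * (x * u x * bessel 1 (c * x)))) => [|x];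
  last by ring.
rewrite integralTZ; last exact: tame2.
move: (integralT _) (rsq _ _)%:R (_^-1) => I r d.
by ring.
Qed.

Lemma sphere_term0 n : sphere_term (fun=> 0) n = 0.
Proof.
rewrite (_ : (fun=> 0) = (fun x => 0 * (fun=> 0) x)); last first.
  by apply/funext => x; rewrite mul0r.
by rewrite sphere_termZ ?mul0r//; exact: rapid0.
Qed.

Lemma sphere_term_sum m (F : nat -> R -> R) n : (forall i, rapid (F i)) ->
  sphere_term (fun x => \sum_(i < m) F i x) n = \sum_(i < m) sphere_term (F i) n.
Proof.
move=> rF; elim: m => [|m ih].
  rewrite big_ord0 -[RHS](sphere_term0 n); congr (sphere_term _ n).
  by apply/funext => x; rewrite big_ord0.
rewrite big_ord_recr/= -ih -sphere_termD//; last exact: rapid_sum.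
by congr (sphere_term _ n); apply/funext => x; rewrite big_ord_recr.
Qed.

(** With xi = sqrt n, thirteen integrations by parts bound the transform by
xi ^ (- 12), and the factor xi ^ (- 3) of the term makes this n ^ (- 15/2). This
beats the crude bound (2 n + 1) ^ 5 on r_5 (n), with a summable remainder. *)
Lemma sphere_term_le : exists C, forall (u : nat -> R -> R) A, chain u ->
  (forall x, `|u 0%N x| <= A * lorentz x ^+ 7) ->
  (forall x, `|u 13%N x| <= A * lorentz x ^+ 16) ->
  forall n, `|sphere_term (u 0%N) n| <= C * A / n.+1%:R ^+ 2.
Proof.
have [C hC] := @chain_bessel_le R 13.
have pi0 := @pi_gt0 R; have pi2 := @pi_ge2 R.
(* C1 is for n = 0; the factor 4 in C2 is for n + 2 <= 2 (n + 1). *)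
pose C1 := 1 + (6 * pi)^-1 * (2 * pi) ^+ 3 * integralT (@lorentz R).
pose C2 := 4 * (3 ^+ 5 * (1 + `|C|)).
have C10 : 0 <= C1.
  by rewrite addr_ge0// mulr_ge0 ?integralT_lorentz_ge0// mulr_ge0 ?invr_ge0
    ?exprn_ge0 ?mulr_ge0// ltW.
exists (C1 + C2) => u A hu hA0 hA13 n; have [ru _ _] := hu.
have A0 : 0 <= A.
  by rewrite -(pmulr_lge0 _ (exprn_gt0 7 (lorentz_gt0 0))) (le_trans _ (hA0 0)).
have C20 : 0 <= C2 by rewrite /C2 !mulr_ge0 ?exprn_ge0 ?addr_ge0.
case: n => [|n].
  rewrite expr1n divr1 mulrDl (@le_trans _ _ (C1 * A))//; last first.
    by rewrite lerDl mulr_ge0.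
  rewrite /sphere_term (le_trans (ler_normB _ _))// /C1 [leRHS]mulrDl mul1r; apply: lerD.
    rewrite (le_trans (hA0 0))// ler_piMr// exprn_ile1//.
      by rewrite ltW ?lorentz_gt0.
    exact: lorentz_le1.
  rewrite [leRHS](_ : _ = (6 * pi)^-1 * ((2 * pi) ^+ 3 * A * integralT lorentz));
    last by ring.
  rewrite normrM ger0_norm ?invr_ge0 ?mulr_ge0 ?(ltW pi0)// ler_wpM2l//.
    by rewrite invr_ge0 mulr_ge0// ltW.
  apply: integralT_norm_le; first by case: (tame1 (ru 0%N)).
  move=> x; set L := lorentz x; set y := 1 + x ^+ 2.
  have Ly : y * L = 1 by exact: lorentzK.
  have y1 : 1 <= y by exact: oneDsqr_ge1.
  have L0 : 0 <= L by rewrite ltW ?lorentz_gt0.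
  have L1 : L <= 1 by exact: lorentz_le1.
  have hx : `|x ^+ 4| <= y ^+ 2.
    rewrite (exprM x 2 2) ger0_norm ?sqr_ge0//.
    by apply: lerXn2r; rewrite ?nnegrE ?sqr_ge0// ?lerDr// (le_trans _ y1).
  have e : (2 * pi * x) ^+ 3 * (x * u 0%N x) = (2 * pi) ^+ 3 * (x ^+ 4 * u 0%N x).
    by ring.
  rewrite /= e.
  rewrite normrM ger0_norm ?exprn_ge0 ?mulr_ge0 ?(ltW pi0)// -mulrA ler_wpM2l//.
    by rewrite exprn_ge0// mulr_ge0// ltW.
  rewrite normrM; apply: le_trans (ler_pM _ _ hx (hA0 x)) _ => //.
  rewrite [leLHS](_ : _ = A * ((y * L) ^+ 2 * L ^+ 5)); last by rewrite -/L; ring.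
  rewrite Ly expr1n mul1r ler_wpM2l// exprS ler_piMr// exprn_ile1//.
set N : R := n.+1%:R; set xi := Num.sqrt N; set c := 2 * pi * xi.
have N1 : 1 <= N by rewrite ler1n.
have N0 : 0 < N by exact: lt_le_trans N1.
have xi0 : 0 < xi by rewrite sqrtr_gt0.
have xi2 : xi ^+ 2 = N by rewrite sqr_sqrtr// ltW.
have xi1 : 1 <= xi.
  by rewrite -(ler_pXn2r (n := 2)) ?nnegrE ?(ltW xi0)// xi2 expr1n.
have c1 : 1 <= c by rewrite /c; nra.
have c0 : 0 < c by exact: lt_le_trans c1.
have r5 : (rsq 5 n.+1)%:R <= (3 * N) ^+ 5 :> R.
  rewrite -[3 : R]/(3%:R) -natrM -natrX ler_nat (leq_trans (rsq_le _ _))//.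
  by rewrite leq_exp2r//; lia.
have r0 : 0 <= (rsq 5 n.+1)%:R :> R by [].
have bI : `|integralT (fun x => x * u 0%N x * bessel 1 (c * x))| <= `|C| * A * xi ^- 12.
  have := hC u A c hu c1 hA13; set I := `|_| => h.
  have h2 : I <= `|C| * A * c ^- 12.
    rewrite ler_pdivlMr ?exprn_gt0//.
    rewrite -(ler_pM2r (exprn_gt0 14 c0)) -mulrA -exprD; apply: le_trans h _.
    by rewrite ler_wpM2r ?exprn_ge0 ?(ltW c0)// ler_wpM2r// ler_norm.
  apply: le_trans h2 _; rewrite ler_wpM2l ?mulr_ge0//.
  rewrite lef_pV2 ?posrE ?exprn_gt0//; apply: lerXn2r; rewrite ?nnegrE ?(ltW xi0) ?(ltW c0)//.
  by rewrite /c ler_peMl ?(ltW xi0)//; nra.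
rewrite /sphere_term -/N -/xi -/c normrM (ger0_norm r0).
have b1 : `|u 0%N xi| <= A * N ^- 7.
  apply: le_trans (hA0 xi) _; rewrite ler_wpM2l// lorentzV lef_pV2 ?posrE.
  - by apply: lerXn2r; rewrite ?nnegrE ?addr_ge0 ?sqr_ge0 ?(ltW N0)// xi2 lerDr.
  - by rewrite exprn_gt0// xi2 ltr_wpDl.
  - by rewrite exprn_gt0.
have b2 : `|(2 * pi * xi ^+ 3)^-1 * integralT (fun x => x * u 0%N x * bessel 1 (c * x))|
    <= `|C| * A * N ^- 7.
  rewrite normrM ger0_norm; last by rewrite invr_ge0 ?mulr_ge0 ?exprn_ge0 ?ltW.
  apply: (@le_trans _ _ (xi ^- 3 * (`|C| * A * xi ^- 12))).
    apply: ler_pM => //; first by rewrite invr_ge0 ?mulr_ge0 ?exprn_ge0 ?ltW.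
    rewrite lef_pV2 ?posrE ?exprn_gt0 ?mulr_gt0 ?exprn_gt0//.
    by rewrite ler_peMl ?exprn_ge0 ?(ltW xi0)//; nra.
  rewrite mulrCA ler_wpM2l ?mulr_ge0// -invfM -exprD -xi2 -exprM.
  by rewrite lef_pV2 ?posrE ?exprn_gt0// ler_weXn2l.
apply: (@le_trans _ _ ((3 * N) ^+ 5 * (A * N ^- 7 + `|C| * A * N ^- 7))).
  apply: ler_pM => //; apply: le_trans (ler_normB _ _) _; exact: lerD.
rewrite [leLHS](_ : _ = 3 ^+ 5 * (1 + `|C|) * A / N ^+ 2); last first.
  by field; rewrite gt_eqF.
have N2 : n.+2%:R <= 2 * N by rewrite /N -(natr1 n.+1); lra.
apply: (@le_trans _ _ (C2 * A / n.+2%:R ^+ 2)); last first.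
  by rewrite ler_wpM2r ?invr_ge0 ?exprn_ge0// ler_wpM2r// lerDr.
have -> : 3 ^+ 5 * (1 + `|C|) * A / N ^+ 2 = C2 * A / (2 * N) ^+ 2.
  by rewrite /C2; field; rewrite gt_eqF.
rewrite ler_wpM2l ?mulr_ge0// lef_pV2 ?posrE ?exprn_gt0 ?mulr_gt0//.
by apply: lerXn2r; rewrite ?nnegrE ?mulr_ge0// ltW.
Qed.

End summation_terms.

(** * The formula for Gaussians *)

Section gaussian_terms.
Context {R : realType}.
Implicit Types (c t x : R).

(** A Gaussian is an eigenfunction of h |-> h' / x. *)
Definition gauss_chain t (j : nat) (x : R) : R := (- (2 * t)) ^+ j * gauss t x.

Lemma chain_gauss t : 0 < t -> chain (gauss_chain t).
Proof.
move=> t0; split.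
- by move=> j; apply: rapidZ; exact: rapid_gauss.
- move=> j x; apply: is_derive_eq (is_derive_mul (is_derive_const _ x) (is_derive_gauss t x)) _.
  by rewrite /gauss_chain exprS; ring.
- by move=> j x; rewrite /gauss_chain gaussN.
Qed.

Let gauss_parts t (G g : R -> R) : 0 < t -> moderate G -> moderate g ->
  (forall x : R, is_derive x 1 G (g x)) ->
  integralT (fun x => x * gauss t x * G x) =
  (2 * t)^-1 * integralT (fun x => gauss t x * g x).
Proof.
move=> t0 mG mg dG; have rg := @rapid_gauss R _ t0.
have dF (x : R) : is_derive x 1 (fun y => - (2 * t)^-1 * gauss t y) (x * gauss t x).
  apply: is_derive_eq (is_derive_mul (is_derive_const _ x) (is_derive_gauss t x)) _.
  by field; rewrite gt_eqF.
have rx : rapid (fun x => x * gauss t x) by apply: rapidMl => //; exact: moderate_id.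
rewrite (integralT_parts (rapidZ _ rg) rx mG mg dF dG).
rewrite (eq_integralT (g := fun x => - (2 * t)^-1 * (gauss t x * g x))) => [|x]; last first.
  by rewrite mulrA.
by rewrite integralTZ ?mulNr ?opprK//; exact/rapid_tame/rapidM.
Qed.

Lemma integralT_xgauss_bessel t c : 0 < t ->
  integralT (fun x => x * gauss t x * bessel 1 (c * x)) =
  c ^+ 3 / (2 * t) ^+ 2 * gauss_cos t c.
Proof.
move=> t0.
have dG (x : R) : is_derive x 1 (fun y => bessel 1 (c * y)) (c ^+ 2 * (x * sin (c * x))).
  apply: is_derive_eq (is_derive_scale (is_derive_bessel 0 (c * x))) _.
  by rewrite expr2 /bessel; ring.
have ms : moderate (fun x => x * sin (c * x)).
  by apply: moderateM; [exact: moderate_id|exact: moderate_sin].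
rewrite (gauss_parts t0 (moderate_bessel 1 c) _ dG); last first.
  by apply: moderateM => //; exact: moderate_cst.
rewrite (eq_integralT (g := fun x => c ^+ 2 * (x * gauss t x * sin (c * x)))) => [|x]; last by ring.
rewrite integralTZ; last first.
  apply/rapid_tame/rapidM; last exact: moderate_sin.
  by apply: rapidMl; [exact: moderate_id|exact: rapid_gauss].
by rewrite integralT_xgauss_sin//; field; rewrite gt_eqF.
Qed.

Lemma integralT_x4gauss t : 0 < t ->
  integralT (fun x => x ^+ 4 * gauss t x) = 3 / (2 * t) ^+ 2 * Num.sqrt (pi / t).
Proof.
move=> t0.
have m2 : moderate (fun x : R => x ^+ 2).
  by apply: moderateM; exact: moderate_id.
have m3 : moderate (fun x : R => x ^+ 3).
  by rewrite (_ : (fun x => _) = fun x => x * x ^+ 2);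
    [apply: moderateM => //; exact: moderate_id|apply/funext => x; ring].
rewrite (eq_integralT (g := fun x => x * gauss t x * x ^+ 3)) => [|x]; last by ring.
rewrite (gauss_parts t0 m3 _ (is_derive_pow 3)); last first.
  by apply: moderateM => //; exact: moderate_cst.
have rg := @rapid_gauss R _ t0.
rewrite (eq_integralT (g := fun x => 3 * (x * gauss t x * x))) => [|x]; last by rewrite /=; ring.
rewrite integralTZ; last first.
  apply/rapid_tame/rapidM; last exact: moderate_id.
  by apply: rapidMl => //; exact: moderate_id.
rewrite (gauss_parts t0 moderate_id (moderate_cst 1) (@is_derive_var R)).
rewrite (eq_integralT (g := gauss t)) => [|x]; last by rewrite mulr1.
by rewrite integralT_gauss_scaled//; field; rewrite gt_eqF.
Qed.

Lemma rsq0 k : rsq k 0 = 1%N.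
Proof.
rewrite /rsq -/(sphere k 0) (_ : sphere k 0 = [set 0]) ?fset_set1 ?cardfs1//.
apply/seteqP; split => [m /= m0|_ /= ->]; last first.
  by rewrite /sphere/= big1// => i _; rewrite mxE expr0n.
apply/rowP => i; rewrite mxE; apply/eqP; rewrite -sqrf_eq0; apply/eqP.
have /eqP := m0; rewrite psumr_eq0 => [|j _]; last exact: sqr_ge0.
by move=> /allP /(_ i); rewrite mem_index_enum => /(_ isT) /eqP.
Qed.

(** The Gaussian being its own transform up to scaling, the n-th term is the
difference of the n-th terms of the fifth powers of two theta series. *)
Lemma sphere_term_gauss t n : 0 < t -> sphere_term (gauss t) n =
  (rsq 5 n)%:R * expR (- (t * n%:R)) -
  Num.sqrt (pi / t) ^+ 5 * ((rsq 5 n)%:R * expR (- (pi ^+ 2 / t * n%:R))).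
Proof.
move=> t0; have pi0 := @pi_gt0 R.
have s2 : Num.sqrt (pi / t) ^+ 2 = pi / t by rewrite sqr_sqrtr// divr_ge0 ?ltW.
have s5 : Num.sqrt (pi / t) ^+ 5 = pi ^+ 2 / t ^+ 2 * Num.sqrt (pi / t).
  by rewrite exprSr (exprM _ 2 2) s2 expr_div_n.
case: n => [|n].
  rewrite /sphere_term rsq0 !mulr0 oppr0 expR0 !mulr1.
  have -> : gauss t 0 = 1 by rewrite /gauss expr0n/= mulr0 oppr0 expR0.
  rewrite (eq_integralT (g := fun x => (2 * pi) ^+ 3 * (x ^+ 4 * gauss t x))) => [|x]; last by ring.
  rewrite integralTZ; last first.
    apply/rapid_tame/rapidMl; last exact: rapid_gauss.
    rewrite (_ : (fun x => _) = fun x => x * (x * (x * x))); last by apply/funext => x; ring.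
    by do 3?apply: moderateM => //; exact: moderate_id.
  rewrite integralT_x4gauss// s5; congr (_ - _).
  move: (Num.sqrt _) => s; move: pi pi0 => p p0.
  by field; rewrite !gt_eqF.
rewrite /sphere_term; set xi := Num.sqrt n.+1%:R.
have xi0 : 0 < xi by rewrite sqrtr_gt0.
have xi2 : xi ^+ 2 = n.+1%:R by rewrite sqr_sqrtr.
rewrite integralT_xgauss_bessel// gauss_cosE// mulrBr; congr (_ - _).
  by rewrite /gauss xi2.
rewrite [RHS]mulrCA; congr (_ * _).
have -> : (2 * pi * xi) ^+ 2 / (4 * t) = pi ^+ 2 / t * n.+1%:R.
  rewrite -xi2; move: pi pi0 => p p0; field; rewrite gt_eqF//.
rewrite s5; move: (expR _) (Num.sqrt (pi / t)) => e s; move: pi pi0 => p p0.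
by field; rewrite !gt_eqF.
Qed.

(** The fifth power of the theta inversion. *)
Lemma sphere_term_gauss_cvg t : 0 < t ->
  series (sphere_term (gauss t)) @ \oo --> (0 : R).
Proof.
move=> t0; have s0 : 0 < pi ^+ 2 / t by rewrite divr_gt0// exprn_gt0// pi_gt0.
have h1 := @rsq_generating_function R t 5 t0.
have h2 := @rsq_generating_function R _ 5 s0.
have -> : (0 : R) = theta t ^+ 5 - Num.sqrt (pi / t) ^+ 5 * theta (pi ^+ 2 / t) ^+ 5.
  by rewrite -exprMn -theta_inversion// subrr.
pose a c n : R := (rsq 5 n)%:R * expR (- (c * n%:R)).
rewrite (_ : series _ = (fun N => series (a t) N -
    Num.sqrt (pi / t) ^+ 5 * series (a (pi ^+ 2 / t)) N)).
  by apply: cvgB => //; apply: cvgM => //; exact: cvg_cst.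
apply/funext => N; rewrite /series/= mulr_sumr -sumrB; apply: eq_bigr => n _.
by rewrite sphere_term_gauss.
Qed.

End gaussian_terms.

(** * Weierstrass approximation *)

Section weierstrass.
Context {R : realType}.
Implicit Types (f : R -> R) (g h : nat -> R) (x e : R).

(** The n-th Bernstein operator, whose value at x is the mean of g over a
binomial variable with parameters n and x; this recursion conditions on the
first trial. *)
Fixpoint bernstein n g : {poly R} :=
  if n is n'.+1 then 'X * bernstein n' (fun k => g k.+1) + (1 - 'X) * bernstein n' g
  else (g 0%N)%:P.

Lemma bernsteinS n g x : (bernstein n.+1 g).[x] =
  x * (bernstein n (fun k => g k.+1)).[x] + (1 - x) * (bernstein n g).[x].
Proof. by rewrite /= !hornerE. Qed.

Lemma bernstein_le n g h x : 0 <= x <= 1 -> (forall k, (k <= n)%N -> g k <= h k) ->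
  (bernstein n g).[x] <= (bernstein n h).[x].
Proof.
move=> x01; have /andP[x0 x1] := x01.
elim: n g h => [|n ih] g h gh; first by rewrite /= !hornerE gh.
rewrite !bernsteinS lerD// ler_wpM2l ?subr_ge0//; apply: ih => k kn.
  exact: gh.
by apply: gh; rewrite leqW.
Qed.

Lemma bernstein_linear n g h a x :
  (bernstein n (fun k => a * g k + h k)).[x] =
  a * (bernstein n g).[x] + (bernstein n h).[x].
Proof.
elim: n g h => [|n ih] g h; first by rewrite /= !hornerE.
rewrite !bernsteinS (ih g h) (ih (fun k => g k.+1) (fun k => h k.+1)).
by ring.
Qed.

Lemma bernstein_cst n a x : (bernstein n (fun=> a)).[x] = a.
Proof.
elim: n => [|n ih]; first by rewrite /= hornerE.
by rewrite bernsteinS ih; ring.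
Qed.

(** The second moment of the binomial law about an arbitrary point. *)
Lemma bernstein_sqr n a x : (bernstein n (fun k => (k%:R + a) ^+ 2)).[x] =
  (n%:R * x + a) ^+ 2 + n%:R * x * (1 - x).
Proof.
elim: n a => [|n ih] a; first by rewrite /= hornerE; ring.
rewrite bernsteinS ih.
rewrite (_ : (fun k => _) = (fun k => (k%:R + (1 + a)) ^+ 2)); last first.
  by apply/funext => k; rewrite -natr1 addrA.
by rewrite ih -natr1; ring.
Qed.

(** Uniform continuity on [0, 1], in the form that the second moment can use. *)
Lemma continuous_modulus f e : continuous f -> 0 < e -> exists K, 0 <= K /\
  forall x y, 0 <= x <= 1 -> 0 <= y <= 1 -> `|f y - f x| <= e + K * (y - x) ^+ 2.
Proof.
move=> cf e0.
have [B [B0 fB]] : exists B, 0 <= B /\ forall x, 0 <= x <= 1 -> `|f x| <= B.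
  have cn : {within `[0, 1], continuous (fun x => `|f x|)}.
    apply: continuous_subspaceT => x; apply: continuous_comp; first exact: cf.
    exact: norm_continuous.
  have [c _ hc] := EVT_max (@ler01 R) cn.
  by exists `|f c|; split => // x x01; apply: hc; rewrite in_itv.
have : \forall K \near +oo, `[0, 1]%classic `<=`
    (fun x => forall y, 0 <= y <= 1 -> `|f y - f x| <= e + K * (y - x) ^+ 2).
  apply: (compact_near_coveringP _).1; first exact: segment_compact.
  move=> x0 /=; rewrite in_itv/= => x01.
  have e20 : 0 < e / 2 by rewrite divr_gt0.
  have [/= d d0 dP] := (@cvgrPdist_lt _ _ _ _ _ f (f x0)).1 (cf x0) _ e20.
  have d20 : 0 < d / 2 by rewrite divr_gt0.
  near=> z K => y y01.
  have zx : `|x0 - z| < d / 2.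
    by near: z; exact: (@nbhsx_ballx _ _ x0 _ d20).
  have hK : 8 * B / d ^+ 2 <= K by near: K; apply: nbhs_pinfty_ge; exact: num_real.
  have fz : `|f x0 - f z| < e / 2.
    by apply: dP => /=; rewrite (lt_trans zx)//; lra.
  have K0 : 0 <= K.
    by apply: le_trans hK; rewrite divr_ge0 ?sqr_ge0 ?mulr_ge0.
  have Kyz : 0 <= K * (y - z) ^+ 2 by rewrite mulr_ge0// sqr_ge0.
  have [yd|yd] := ltP `|x0 - y| d.
    have fy : `|f x0 - f y| < e / 2 by exact: dP.
    rewrite (_ : f y - f z = (f x0 - f z) - (f x0 - f y)); last by ring.
    apply: le_trans (ler_normB _ _) _.
    by rewrite (le_trans (lerD (ltW fz) (ltW fy)))// -splitr lerDl.
  have yz : d / 2 <= `|y - z|.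
    have := ler_normB (x0 - z) (y - z).
    by rewrite (_ : x0 - z - (y - z) = x0 - y); [lra|ring].
  have z01 : `|f z| <= B + e / 2.
    rewrite (_ : f z = f x0 - (f x0 - f z)); last by ring.
    by apply: le_trans (ler_normB _ _) _; have := fB _ x01; lra.
  apply: le_trans (ler_normB _ _) _.
  have h : 2 * B <= K * (y - z) ^+ 2.
    apply: (@le_trans _ _ (K * (d / 2) ^+ 2)).
      have : 8 * B / d ^+ 2 * (d / 2) ^+ 2 <= K * (d / 2) ^+ 2.
        by rewrite ler_wpM2r ?sqr_ge0.
      by apply: le_trans; rewrite [leRHS](_ : _ = 2 * B)//; field; rewrite gt_eqF.
    rewrite ler_wpM2l// -[(y - z) ^+ 2]real_normK ?num_real//.
    by apply: lerXn2r; rewrite ?nnegrE// ltW.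
  by have := fB _ y01; move: (K * _) h => T h; lra.
move=> h; near (+oo : set_system R) => K; exists K; split; first by [].
have KP : `[0, 1]%classic `<=`
    (fun x => forall y, 0 <= y <= 1 -> `|f y - f x| <= e + K * (y - x) ^+ 2).
  by near: K.
by move=> x y x01; apply: KP; rewrite /= in_itv.
Unshelve. all: end_near. Qed.

(** The Bernstein polynomials: the variance of the frequency of success is at
most 1 / n. *)
Lemma weierstrass_approximation f e : continuous f -> 0 < e ->
  exists p : {poly R}, forall x, 0 <= x <= 1 -> `|f x - p.[x]| <= e.
Proof.
move=> cf e0; have e20 : 0 < e / 2 by rewrite divr_gt0.
have [K [K0 hK]] := continuous_modulus cf e20.
pose n := Num.truncn (2 * K / e).
have n1 : 2 * K / e <= n.+1%:R.
  by apply/ltW/truncnS_gt.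
have N0 : 0 < n.+1%:R :> R by [].
pose g k := f (k%:R / n.+1%:R).
exists (bernstein n.+1 g) => x x01; have /andP[x0 x1] := x01.
pose h k : R := K / n.+1%:R ^+ 2 * (k%:R + - (n.+1%:R * x)) ^+ 2 + e / 2.
have hE : (bernstein n.+1 h).[x] <= e.
  rewrite bernstein_linear bernstein_sqr bernstein_cst subrr expr0n/= add0r.
  rewrite [leRHS]splitr lerD2r.
  rewrite [leLHS](_ : _ * _ = K / n.+1%:R * (x * (1 - x))); last first.
    by move: (n.+1%:R : R) N0 => m m0; field; rewrite gt_eqF.
  have xx : x * (1 - x) <= 1 by nra.
  have xx0 : 0 <= x * (1 - x) by rewrite mulr_ge0// subr_ge0.
  apply: (@le_trans _ _ (K / n.+1%:R)); first by rewrite ler_piMr// divr_ge0.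
  rewrite ler_pdivrMr//; rewrite ler_pdivrMr// in n1.
  by move: (n.+1%:R : R) N0 n1 => m m0 n1; lra.
have gh k : (k <= n.+1)%N -> `|g k - f x| <= h k.
  move=> kn; have k01 : 0 <= (k%:R / n.+1%:R : R) <= 1.
    by rewrite divr_ge0//= ler_pdivrMr// mul1r ler_nat.
  apply: le_trans (hK _ _ x01 k01) _; rewrite /h addrC lerD2r le_eqVlt.
  apply/orP; left; apply/eqP; move: (n.+1%:R : R) N0 => m m0.
  by field; rewrite gt_eqF.
apply: le_trans hE; rewrite distrC ler_norml; apply/andP; split.
  rewrite lerNl opprB.
  have := @bernstein_linear n.+1 g (fun=> f x) (-1) x; rewrite bernstein_cst mulN1r addrC => <-.
  apply: bernstein_le => // k kn; have := gh k kn; rewrite distrC => /(le_trans (ler_norm _)).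
  by rewrite mulN1r addrC.
have := @bernstein_linear n.+1 g (fun=> - f x) 1 x; rewrite bernstein_cst mul1r => <-.
apply: bernstein_le => // k kn; have := gh k kn => /(le_trans (ler_norm _)).
by rewrite mul1r.
Qed.

End weierstrass.

(** * Density of Gaussians *)

Section chain_algebra.
Context {R : realType}.
Implicit Types (u v : nat -> R -> R) (a x : R).

Lemma chainD u v : chain u -> chain v -> chain (fun j x => u j x + v j x).
Proof.
move=> [ru du eu] [rv dv ev]; split=> [j|j x|j x]; first exact: rapidD.
  by apply: is_derive_eq (is_derive_add (du j x) (dv j x)) _; rewrite mulrDr.
by rewrite eu ev.
Qed.

Lemma chainZ a u : chain u -> chain (fun j x => a * u j x).
Proof.
move=> [ru du eu]; split=> [j|j x|j x]; first exact: rapidZ.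
  apply: is_derive_eq (is_derive_mul (is_derive_const a x) (du j x)) _.
  by rewrite mul0r add0r mulrCA.
by rewrite eu.
Qed.

Lemma chain0 : chain (fun _ (_ : R) => 0).
Proof.
split=> [j|j x|//]; first exact: rapid0.
by apply: is_derive_eq (is_derive_const 0 x) _; rewrite mulr0.
Qed.

Lemma chain_sum n (U : nat -> nat -> R -> R) : (forall i, chain (U i)) ->
  chain (fun j x => \sum_(i < n) U i j x).
Proof.
move=> cU; elim: n => [|n ih].
  rewrite (_ : (fun j => _) = (fun _ (_ : R) => 0)); first exact: chain0.
  by apply/funext => j; apply/funext => x; rewrite big_ord0.
rewrite (_ : (fun j => _) = (fun j x => \sum_(i < n) U i j x + U n j x)).
  exact: chainD.
by apply/funext => j; apply/funext => x; rewrite big_ord_recr.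
Qed.

(** A lorentz ^ (m + 1) - u j decreases on the half-line and tends to 0. *)
Let chain_le1 u j m A : chain u ->
  (forall x, `|u j.+1 x| <= A * lorentz x ^+ m.+2) ->
  forall x, 0 <= x -> u j x <= A * lorentz x ^+ m.+1.
Proof.
move=> [ru du eu] hA x x0.
have A0 : 0 <= A.
  by rewrite -(pmulr_lge0 _ (exprn_gt0 m.+2 (lorentz_gt0 0))) (le_trans _ (hA 0)).
have dL (y : R) : is_derive y 1 (@lorentz R) (- (2 * y) * lorentz y ^+ 2).
  have y0 : 1 + y ^+ 2 != 0 by rewrite gt_eqF// ltr_pwDl// sqr_ge0.
  have d1 : is_derive y 1 (fun z : R => 1 + z ^+ 2) (2 * y).
    apply: is_derive_eq (is_derive_add (is_derive_const 1 y) (is_derive_pow 2 y)) _.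
    by rewrite expr1 add0r.
  have h := @is_deriveV _ (fun z : R => 1 + z ^+ 2) y _ 1 y0 d1; apply: is_derive_eq h _.
  by rewrite /GRing.scale/= /lorentz; field.
pose G y := A * lorentz y ^+ m.+1 - u j y.
have dG (y : R) : is_derive y 1 G (- (y * (A * (m.+1%:R * 2) * lorentz y ^+ m.+2 + u j.+1 y))).
  have h1 := is_derive_chain (is_derive_pow m.+1 (lorentz y)) (dL y).
  have h2 := is_derive_mul (is_derive_const A y) h1.
  apply: is_derive_eq (is_derive_add h2 (is_derive_opp (du j y))) _.
  by rewrite /= !exprS; ring.
have cG : continuous G := is_derive_continuous dG.
have mono n : x <= n%:R -> G n%:R <= G x.
  move=> xn; apply: (@ler0_derive1_nincry _ G 0) => //.
  - move=> y; rewrite in_itv/= andbT => y0; rewrite derive1E.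
    have [_ ->] := dG y; rewrite oppr_le0 mulr_ge0 ?(ltW y0)//.
    have := hA y; rewrite ler_norml => /andP[h _].
    rewrite -lerBlDr sub0r; apply: le_trans (_ : A * lorentz y ^+ m.+2 <= _).
      by rewrite lerNl.
    rewrite ler_wpM2r ?exprn_ge0 ?lorentz_ge0// ler_peMr//.
    by rewrite -[2]/(2%:R) -natrM ler1n.
  - by apply: continuous_subspaceT.
have lG : exists C, forall y, `|G y| <= C * lorentz y.
  have [_ /(_ 1%N) [C hC]] := ru j; exists (A + C) => y.
  apply: le_trans (ler_normB _ _) _; rewrite mulrDl lerD//.
  rewrite normrM (ger0_norm A0) ger0_norm ?exprn_ge0 ?lorentz_ge0//.
  by rewrite ler_wpM2l// -[leRHS]expr1 lorentz_exp_le.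
have [/cvgr0_norm_lt GN _] := tame_cvg0 lG.
rewrite -subr_ge0 -/(G x) leNgt; apply/negP => Gx.
have Gx0 : 0 < - G x by rewrite oppr_gt0.
near \oo => n.
have h : `|G n%:R| < - G x by near: n; exact: GN.
have xn : x <= n%:R by near: n; exact: nbhs_infty_ger.
have := mono n xn; rewrite leNgt => /negP; apply.
by move: h; rewrite ltr_norml opprK => /andP[].
Unshelve. all: end_near. Qed.

(** Decay propagates down the chain: integrate u_j' = x u_(j+1) from infinity. *)
Lemma chain_le u j m A : chain u ->
  (forall x, `|u j.+1 x| <= A * lorentz x ^+ m.+2) ->
  forall x, `|u j x| <= A * lorentz x ^+ m.+1.
Proof.
move=> cu hA.
suff h x : 0 <= x -> `|u j x| <= A * lorentz x ^+ m.+1.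
  move=> x; have [x0|/ltW x0] := leP 0 x; first exact: h.
  by have [_ _ eu] := cu; rewrite -eu -(lorentzN x) h// oppr_ge0.
move=> x0; rewrite ler_norml; apply/andP; split; last exact: chain_le1.
have := chain_le1 (chainZ (-1) cu) (A := A) (j := j) (m := m) _ x0.
rewrite lerNl mulN1r; apply => y; rewrite mulN1r normrN; exact: hA.
Qed.

Lemma chain_le_iter u k m A : chain u ->
  (forall x, `|u k x| <= A * lorentz x ^+ (k + m.+1)) ->
  forall x, `|u 0%N x| <= A * lorentz x ^+ m.+1.
Proof.
move=> cu; elim: k m => // k ih m hA; apply: ih => x.
by rewrite addnS; apply: chain_le => // y; have := hA y; rewrite addSn addnS.
Qed.

End chain_algebra.

Section density.
Context {R : realType}.
Implicit Types (u : R -> R) (e x : R).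

(** In the variable w = exp (- x ^ 2), on [0, 1], combinations of Gaussians are the
polynomials without constant term, so the Weierstrass theorem applies to u / w,
once u is flattened where w is below a small a. The factor w then pays for the
weight. *)
Lemma gauss_density u M e : rapid u -> (forall x, u (- x) = u x) -> 0 < e ->
  exists n (c : nat -> R), forall x,
    `|u x - \sum_(l < n) c l * gauss l.+1%:R x| <= e * lorentz x ^+ M.
Proof.
move=> [cu ru] eu e0.
have [A hA] := ru M.+1.
have [_ /(_ M)[C hC]] := @rapid_gauss R 1 ltr01.
have A0 : 0 <= A.
  by rewrite -(pmulr_lge0 _ (exprn_gt0 M.+1 (lorentz_gt0 0))) (le_trans _ (hA 0)).
have C0 : 0 <= C.
  by rewrite -(pmulr_lge0 _ (exprn_gt0 M (lorentz_gt0 0))) (le_trans _ (hC 0)).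
(* rho is where the flattening starts, so large that its cost is e / 2. *)
pose rho := 2 * (1 + C) * A / e.
have rho0 : 0 <= rho by rewrite !mulr_ge0 ?invr_ge0 ?addr_ge0// ltW.
have Lrho : (1 + C) * A * lorentz rho <= e / 2.
  have : rho <= 1 + rho ^+ 2 by have := sqr_ge0 (rho - 2^-1); rewrite !expr2; nra.
  move=> h; rewrite ler_pdivrMr ?ltr_pwDl ?sqr_ge0//.
  apply: (@le_trans _ _ (e / 2 * rho)); last by rewrite ler_wpM2l// divr_ge0// ltW.
  by rewrite /rho le_eqVlt; apply/orP; left; apply/eqP; field; rewrite gt_eqF.
pose a := expR (- rho ^+ 2); have a0 : 0 < a by exact: expR_gt0.
pose mx (w : R) := Num.max w a.
have mx0 w : 0 < mx w by rewrite lt_max a0 orbT.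
pose s w := Num.sqrt (- ln (mx w)).
pose q w := u (s w) / mx w.
have cmx : continuous mx.
  rewrite (_ : mx = fun w => (w + a + `|w - a|) / 2); last first.
    by apply/funext => w; rewrite /mx maxr_absE.
  move=> w; apply: cvgM; last exact: cvg_cst.
  apply: cvgD; first by apply: cvgD; [exact: cvg_id|exact: cvg_cst].
  by apply: cvg_norm; apply: cvgB; [exact: cvg_id|exact: cvg_cst].
have cs : continuous s.
  move=> w; apply: continuous_comp; last exact: sqrt_continuous.
  apply: cvgN; apply: continuous_comp; first exact: cmx.
  exact: continuous_ln.
have cq : continuous q.
  move=> w; apply: cvgM.
    by apply: continuous_comp; [exact: cs|exact: cu].
  by apply: cvgV; [rewrite gt_eqF|exact: cmx].
have e'0 : 0 < e / 2 / (1 + C) by rewrite !divr_gt0// ltr_pwDl.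
have [p hp] := weierstrass_approximation cq e'0.
exists (size p), (fun l => p`_l) => x.
pose w := gauss 1 x.
have w0 : 0 < w by exact: expR_gt0.
have w1 : w <= 1 by rewrite /w /gauss mul1r -expR0 ler_expR oppr_le0 sqr_ge0.
have wE l : gauss l.+1%:R x = w * w ^+ l.
  by rewrite -exprS /w /gauss -expRM_natl mul1r mulrN.
have -> : \sum_(l < size p) p`_l * gauss l.+1%:R x = w * p.[w].
  rewrite horner_coef mulr_sumr; apply: eq_bigr => l _.
  by rewrite wE mulrCA.
have L0 : 0 <= lorentz x ^+ M by rewrite exprn_ge0// lorentz_ge0.
have h2 : `|w * q w - w * p.[w]| <= e / 2 * lorentz x ^+ M.
  rewrite -mulrBr normrM gtr0_norm//.
  have wC : w <= C * lorentz x ^+ M by have := hC x; rewrite gtr0_norm.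
  have hq : `|q w - p.[w]| <= e / 2 / (1 + C) by apply: hp; rewrite ltW.
  apply: le_trans (ler_pM _ _ wC hq) _ => //; first exact: ltW.
  rewrite mulrAC ler_wpM2r// [leLHS](_ : _ = e / 2 * (C / (1 + C))); last by ring.
  rewrite ler_piMr ?divr_ge0 ?(ltW e0)//.
  by rewrite ler_pdivrMr ?ltr_pwDl// mul1r lerDr.
suff h1 : `|u x - w * q w| <= e / 2 * lorentz x ^+ M.
  rewrite (_ : u x - w * p.[w] = (u x - w * q w) + (w * q w - w * p.[w])); last by ring.
  apply: le_trans (ler_normD _ _) _.
  rewrite [leRHS](_ : _ = e / 2 * lorentz x ^+ M + e / 2 * lorentz x ^+ M).
    exact: lerD.
  by rewrite -mulrDl -splitr.
have [wa|aw] := ltP w a; last first.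
  have sx : s w = `|x|.
    rewrite /s /mx max_l// /w /gauss expRK opprK mul1r sqrtr_sqr//.
  have -> : w * q w = u x.
    rewrite /q sx /mx max_l// mulrCA divff ?gt_eqF// mulr1.
    by have [x0|x0] := ler0P x => //; rewrite ?eu.
  by rewrite subrr normr0 mulr_ge0// divr_ge0// ltW.
have xr : rho ^+ 2 <= x ^+ 2.
  move: (ltW wa); rewrite /w /gauss /a ler_expR mul1r lerN2//.
have srho : s w = rho.
  by rewrite /s /mx max_r ?ltW// /a expRK opprK sqrtr_sqr ger0_norm.
have Lx : lorentz x <= lorentz rho.
  by rewrite lef_pV2 ?posrE ?ltr_pwDl ?sqr_ge0// lerD2l.
have b1 : `|u x| <= A * lorentz rho * lorentz x ^+ M.
  apply: le_trans (hA x) _; rewrite exprS mulrA ler_wpM2r// ler_wpM2l//.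
have b2 : `|w * q w| <= C * A * lorentz rho * lorentz x ^+ M.
  rewrite /q srho /mx (max_r (ltW wa)) mulrCA normrM mulrC.
  pose z := Num.sqrt (x ^+ 2 - rho ^+ 2).
  have z2 : z ^+ 2 = x ^+ 2 - rho ^+ 2 by rewrite sqr_sqrtr// subr_ge0.
  have wz : w / a = gauss 1 z.
    by rewrite /w /a /gauss -expRN -expRD z2; congr expR; ring.
  rewrite wz; have Lz : lorentz z ^+ M * lorentz rho ^+ M <= lorentz x ^+ M.
    rewrite -exprMn; apply: lerXn2r; rewrite ?nnegrE ?mulr_ge0 ?lorentz_ge0//.
    rewrite -invfM lef_pV2 ?posrE ?mulr_gt0 ?ltr_pwDl ?sqr_ge0// z2.
    by have := sqr_ge0 rho; rewrite !expr2 in xr *; nra.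
  apply: le_trans (ler_pM _ _ (hC z) (hA rho)) _ => //.
  rewrite exprS [leLHS](_ : _ = C * A * lorentz rho * (lorentz z ^+ M * lorentz rho ^+ M)); last by ring.
  by rewrite ler_wpM2l// !mulr_ge0// lorentz_ge0.
apply: le_trans (ler_normB _ _) _; apply: le_trans (lerD b1 b2) _.
rewrite -mulrDl ler_wpM2r//; apply: le_trans Lrho.
by rewrite le_eqVlt; apply/orP; left; apply/eqP; ring.
Qed.

End density.

(** * The formula for chains *)

Section summation_for_chains.
Context {R : realType}.
Implicit Types (u : nat -> R -> R) (x : R).

(** Comparison with the telescoping sum of 1 / (n (n + 1)). *)
Lemma sum_inv_sqr_le N : \sum_(0 <= n < N) (n.+1%:R ^- 2 : R) <= 2.
Proof.
case: N => [|N]; first by rewrite big_geq.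
suff : \sum_(0 <= n < N.+1) (n.+1%:R ^- 2 : R) <= 2 - N.+1%:R^-1.
  by move=> /le_trans; apply; rewrite gerBl invr_ge0.
elim: N => [|N ih]; first by rewrite big_nat1 expr1n invr1; lra.
rewrite big_nat_recr//=; apply: le_trans (lerD ih (lexx _)) _.
rewrite -[N.+2]addn1 natrD.
have := ltr0Sn R N; move: (N.+1%:R) => m m0.
rewrite -addrA lerD2l addrC lerBlDr [leRHS]addrC.
have m10 : 0 < m + 1%:R by rewrite addr_gt0.
have -> : m^-1 - (m + 1%:R)^-1 = (m * (m + 1%:R))^-1.
  by field; rewrite !gt_eqF.
rewrite lef_pV2 ?posrE ?mulr_gt0 ?exprn_gt0// expr2 ler_wpM2r ?(ltW m10)//.
by rewrite lerDl.
Qed.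

Lemma is_cvg_inv_sqr : cvgn (series (fun n => n.+1%:R ^- 2 : R)).
Proof.
apply: nondecreasing_is_cvgn.
  by apply: nondecreasing_series => n _ _; rewrite invr_ge0 exprn_ge0.
by exists 2 => _ [N _ <-]; exact: sum_inv_sqr_le.
Qed.

Lemma is_cvg_series_le_inv_sqr (a : nat -> R) C :
  (forall n, `|a n| <= C / n.+1%:R ^+ 2) -> cvgn (series a).
Proof.
move=> aC; apply: normed_cvg.
apply: (series_le_cvg (v_ := fun n => C * n.+1%:R ^- 2)) => //=.
- by move=> n; exact: le_trans (aC n).
- rewrite (_ : series _ = (fun N => C * series (fun n => n.+1%:R ^- 2) N)).
    by apply: is_cvgM; [exact: is_cvg_cst|exact: is_cvg_inv_sqr].
  by apply/funext => N; rewrite /series/= mulr_sumr.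
Qed.

(** Approximate u 13 by a combination of Gaussians. Dividing the coefficients by
suitable constants gives a combination of chains of Gaussians, on which the sum
is 0, and the remainder, small at index 13, is small at index 0. *)
Theorem sphere_series_chain u : chain u ->
  series (sphere_term (u 0%N)) @ \oo --> (0 : R).
Proof.
move=> cu; have [ru du eu] := cu.
have [C hC] := @sphere_term_le R.
apply/cvgrPdist_le => e e0.
pose d := e / 2 / (2 * `|C| + 1).
have C1 : 0 < 2 * `|C| + 1 by rewrite ltr_wpDl// mulr_ge0.
have d0 : 0 < d by rewrite !divr_gt0.
(* 20 = 13 + 7: one power of the weight is lost for each step down the chain. *)
have [m [c hc]] := gauss_density 20 (ru 13) (eu 13) d0.
pose b (l : nat) := c l / (- (2 * l.+1%:R)) ^+ 13.
have l0 (l : nat) : 0 < l.+1%:R :> R by [].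
pose V l j x := b l * gauss_chain l.+1%:R j x.
have cV l : chain (V l) by apply: chainZ; exact: chain_gauss.
pose v j x := \sum_(l < m) V l j x.
have cv : chain v by exact: chain_sum.
have v13 x : v 13%N x = \sum_(l < m) c l * gauss l.+1%:R x.
  apply: eq_bigr => l _; rewrite /V /gauss_chain /b mulrA divfK//.
  by rewrite expf_neq0// oppr_eq0 mulf_neq0// pnatr_eq0.
pose w j x := u j x + -1 * v j x.
have cw : chain w by apply: chainD => //; exact: chainZ.
have hw x : `|w 13%N x| <= d * lorentz x ^+ 20 by rewrite /w v13 mulN1r; exact: hc.
have hw0 : forall x, `|w 0%N x| <= d * lorentz x ^+ 7.
  by apply: (chain_le_iter (k := 13)).
have hw13 x : `|w 13%N x| <= d * lorentz x ^+ 16.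
  apply: le_trans (hw x) _; rewrite ler_wpM2l ?(ltW d0)//.
  exact: lorentz_exp_le.
have tw := hC w d cw hw0 hw13.
have [rv _ _] := cv; have [rw _ _] := cw.
have tE n : sphere_term (u 0%N) n = sphere_term (w 0%N) n + sphere_term (v 0%N) n.
  rewrite -sphere_termD//; congr (sphere_term _ n); apply/funext => x.
  by rewrite /w mulN1r subrK.
have vE n : sphere_term (v 0%N) n = \sum_(l < m) b l * sphere_term (gauss l.+1%:R) n.
  have rV0 l : rapid (V l 0%N) by have [+ _ _] := cV l.
  rewrite (sphere_term_sum m n rV0); apply: eq_bigr => l _.
  rewrite -sphere_termZ; last exact: rapid_gauss.
  by congr (sphere_term _ n); apply/funext => x; rewrite /V /gauss_chain expr0 mul1r.
have cvgv : series (sphere_term (v 0%N)) @ \oo --> (0 : R).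
  rewrite (_ : series _ = (fun N => \sum_(l < m) b l * series (sphere_term (gauss l.+1%:R)) N)).
    rewrite [X in _ --> X](_ : _ = \sum_(l < m) b l * 0); last first.
      by rewrite big1// => l _; rewrite mulr0.
    apply: cvg_big => [|l _]; first exact: add_continuous.
    apply: cvgM; first exact: cvg_cst.
    exact: sphere_term_gauss_cvg.
  apply/funext => N; rewrite /series/= (eq_bigr _ (fun n _ => vE n)) exchange_big/=.
  by apply: eq_bigr => l _; rewrite mulr_sumr.
have e20 : 0 < e / 2 by rewrite divr_gt0.
near=> N; rewrite sub0r normrN.
have -> : series (sphere_term (u 0%N)) N =
    series (sphere_term (w 0%N)) N + series (sphere_term (v 0%N)) N.
  by rewrite /series/= -big_split/=; apply: eq_bigr => n _; exact: tE.
rewrite [leRHS]splitr; apply: le_trans (ler_normD _ _) _; apply: lerD; last first.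
  by near: N; exact: (cvgr0_norm_le _ cvgv).
rewrite /series/=; apply: le_trans (ler_norm_sum _ _ _) _.
apply: (@le_trans _ _ (\sum_(0 <= n < N) (`|C| * d) * n.+1%:R ^- 2)).
  apply: ler_sum => n _; apply: le_trans (tw n) _.
  by rewrite ler_wpM2r ?invr_ge0 ?exprn_ge0// ler_wpM2r ?(ltW d0)// ler_norm.
rewrite -mulr_sumr; apply: (@le_trans _ _ (`|C| * d * 2)).
  by rewrite ler_wpM2l ?sum_inv_sqr_le// mulr_ge0// ltW.
rewrite [leLHS](_ : _ = e / 2 * ((2 * `|C|) / (2 * `|C| + 1))); last first.
  by rewrite /d; ring.
by rewrite ler_piMr ?(ltW e20)// ler_pdivrMr// mul1r lerDl.
Unshelve. all: end_near. Qed.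

End summation_for_chains.

(** * Odd Schwartz functions are x times the head of a chain *)

Section division_by_x.
Context {R : realType}.
Implicit Types (F : nat -> R -> R) (x t : R).
Let mu := @lebesgue_measure R.

(** F 0 is a Schwartz function; carrying its derivatives along as data lets each
construction give a formula for all derivatives at once. *)
Definition derivatives F := (forall n, rapid (F n)) /\
  forall n x, is_derive x 1 (F n) (F n.+1 x).

(** When F 0 vanishes at 0, the n-th derivative of F 0 x / x, by Hadamard's
formula; it makes smoothness at 0 manifest. *)
Definition divx F n x := integral_itv (fun t => t ^+ n * F n.+1 (t * x)) 0 1.

Let continuous_integrand F n x : derivatives F ->
  continuous (fun t => t ^+ n * F n.+1 (t * x)).
Proof.
move=> [rF _]; apply: continuous_mul; first exact: exprn_continuous.
rewrite (_ : (fun t => _) = (fun t => F n.+1 (x * t))); last first.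
  by apply/funext => t; rewrite mulrC.
by apply: continuous_scale; case: (rF n.+1).
Qed.

Lemma is_derive_divx F n x : derivatives F -> is_derive x 1 (divx F n) (divx F n.+1 x).
Proof.
move=> dF; have [rF hF] := dF.
have [_ /(_ 0%N)[C hC]] := rF n.+2.
have C0 : 0 <= C by have := hC 0; rewrite expr0 mulr1; exact: le_trans.
pose f a t := t ^+ n * F n.+1 (t * a).
have df a t : is_derive a (1 : R) (f ^~ t : R -> R) (t ^+ n.+1 * F n.+2 (t * a)).
  have h := is_derive_mul (is_derive_const (t ^+ n) a) (is_derive_scale (hF n.+1 (t * a))).
  by apply: is_derive_eq h _; rewrite exprS; ring.
have dE a t : derive1 (f ^~ t : R -> R) a = t ^+ n.+1 * F n.+2 (t * a).
  by rewrite derive1E; have := df a t => -[].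
have Ix : `]x - 1, x + 1[%classic x by rewrite /= in_itv/=; apply/andP; split; lra.
have m01 : measurable (`[0 : R, 1]%classic : set (measurableTypeR R)) by [].
have h1 a : `]x - 1, x + 1[%classic a -> mu.-integrable `[0, 1] (EFin \o f a).
  by move=> _; apply: integrable_itv; exact: continuous_integrand.
have h2 a t : `]x - 1, x + 1[%classic a -> `[0, 1]%classic t -> derivable (f ^~ t) a 1.
  by move=> _ _; have := df a t => -[].
have h3 (t : measurableTypeR R) : 0 <= (fun _ : measurableTypeR R => C) t by [].
have h4 : mu.-integrable `[0, 1] (EFin \o (fun=> C)).
  by apply: integrable_itv => t; exact: cvg_cst.
have h5 a t : `]x - 1, x + 1[%classic a -> `[0, 1]%classic t ->
    `|partial1of2 f a t| <= (fun=> C) t.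
  move=> _; rewrite /= in_itv/= => /andP[t0 t1]; rewrite /partial1of2 dE normrM.
  have := hC (t * a); rewrite expr0 mulr1; apply: le_trans.
  by rewrite ler_piMl// ger0_norm ?exprn_ge0// exprn_ile1.
apply: DeriveDef.
  have h := derivable_under_integral m01 Ix h1 h2 h3 h4 h5.
  exact: h.
rewrite -derive1E.
rewrite (differentiation_under_integral m01 Ix h1 h2 h3 h4 h5).
by apply: eq_Rintegral => t _; rewrite /partial1of2 dE.
Qed.

Lemma divxE F x : derivatives F -> F 0%N 0 = 0 -> F 0%N x = x * divx F 0 x.
Proof.
move=> dF F00; have [rF hF] := dF.
have cI := @continuous_integrand F 0 x dF.
rewrite -integral_itvZ//.
pose P t := F 0%N (x * t).
have dP t : is_derive t 1 P (x * (t ^+ 0 * F 1%N (t * x))).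
  apply: is_derive_eq (is_derive_scale (hF 0%N (x * t))) _.
  by rewrite expr0 mul1r [t * x]mulrC.
have cP := is_derive_continuous dP.
rewrite /integral_itv /Rintegral (continuous_FTC2 (@ltr01 R) (F := P))//=.
- by rewrite /P mulr1 mulr0 F00 subr0.
- apply: continuous_subspaceT; apply: continuous_mul => //.
  by move=> t; exact: cvg_cst.
- split.
  + by move=> t _; have := dP t => -[].
  + by apply: cvg_at_right_filter; exact: cP.
  + by apply: cvg_at_left_filter; exact: cP.
- by move=> t _; rewrite derive1E; have := dP t => -[].
Qed.

(** The Leibniz rule for the product of x and F 0 x / x. *)
Lemma divx_leibniz F n x : derivatives F -> F 0%N 0 = 0 ->
  x * divx F n.+1 x + n.+1%:R * divx F n x = F n.+1 x.
Proof.
move=> dF F00; have [rF hF] := dF.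
have uniq_der (f : R -> R) (a b c : R) :
    is_derive a 1 f b -> is_derive a 1 f c -> b = c by move=> [_ <-] [_ <-].
elim: n x => [|n ih] x.
  apply: (fun h => uniq_der (F 0%N) x _ _ h (hF 0%N x)).
  rewrite (_ : F 0%N = (fun y => y * divx F 0 y)); last first.
    by apply/funext => y; exact: divxE.
  apply: is_derive_eq (is_derive_mul (is_derive_var x) (is_derive_divx 0 x dF)) _.
  by ring.
apply: (fun h => uniq_der (F n.+1) x _ _ h (hF n.+1 x)).
rewrite (_ : F n.+1 = (fun y => y * divx F n.+1 y + n.+1%:R * divx F n y)); last first.
  by apply/funext => y; rewrite ih.
have h1 := is_derive_mul (is_derive_var x) (is_derive_divx n.+1 x dF).
have h2 := is_derive_mul (is_derive_const n.+1%:R x) (is_derive_divx n x dF).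
apply: is_derive_eq (is_derive_add h1 h2) _.
by rewrite -(natr1 n.+1); ring.
Qed.

Let divx_bounded F n : derivatives F -> exists C, forall x, `|divx F n x| <= C.
Proof.
move=> dF; have [rF hF] := dF.
have [_ /(_ 0%N)[C hC]] := rF n.+1; exists C => x.
have cI := @continuous_integrand F n x dF.
have cC : continuous (fun _ : R => C) by move=> t; exact: cvg_cst.
have cN : continuous (fun _ : R => - C) by move=> t; exact: cvg_cst.
have b t : 0 <= t <= 1 -> `|t ^+ n * F n.+1 (t * x)| <= C.
  move=> /andP[t0 t1]; have := hC (t * x); rewrite expr0 mulr1; apply: le_trans.
  by rewrite normrM ler_piMl// ger0_norm ?exprn_ge0// exprn_ile1.
rewrite ler_norml; apply/andP; split.
  rewrite (_ : - C = integral_itv (fun=> - C) 0 1); last first.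
    by rewrite integral_itv_cst// subr0 mulr1.
  by apply: integral_itv_le => // t /b; rewrite ler_norml => /andP[].
rewrite (_ : C = integral_itv (fun=> C) 0 1); last first.
  by rewrite integral_itv_cst// subr0 mulr1.
by apply: integral_itv_le => // t /b; rewrite ler_norml => /andP[].
Qed.

(** Near the origin the quotient is bounded by the integral formula; elsewhere its
decay comes from that of F. *)
Lemma derivatives_divx F : derivatives F -> F 0%N 0 = 0 -> derivatives (divx F).
Proof.
move=> dF F00; have [rF hF] := dF.
have cD n : continuous (divx F n).
  by apply: (@is_derive_continuous _ _ (divx F n.+1)) => x; exact: is_derive_divx.
(* away from the origin, solve the Leibniz rule for the highest derivative *)
have far n m : exists C, forall x, 1 <= `|x| -> `|divx F n x| <= C * lorentz x ^+ m.
  elim: n => [|n [C hC]].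
    have [_ /(_ m)[C hC]] := rF 0%N; exists C => x x1.
    apply: le_trans (hC x); rewrite (divxE x dF F00) normrM.
    by rewrite ler_peMl.
  have [_ /(_ m)[D hD]] := rF n.+1; exists (D + n.+1%:R * C) => x x1.
  apply: (@le_trans _ _ `|x * divx F n.+1 x|); first by rewrite normrM ler_peMl.
  have -> : x * divx F n.+1 x = F n.+1 x - n.+1%:R * divx F n x.
    by rewrite -(divx_leibniz n x dF F00) addrK.
  apply: le_trans (ler_normB _ _) _; rewrite mulrDl lerD//.
  by rewrite normrM ger0_norm// -mulrA ler_wpM2l// hC.
split=> [n|n x]; last exact: is_derive_divx.
split; first exact: cD.
move=> m; have [C hC] := far n m; have [B hB] := divx_bounded n dF.
have B0 : 0 <= B by exact: le_trans (hB 0).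
exists (`|C| + B * 2 ^+ m) => x; rewrite mulrDl.
have L0 : 0 <= lorentz x ^+ m by rewrite exprn_ge0// lorentz_ge0.
have [x1|x1] := leP 1 `|x|.
  apply: le_trans (hC x x1) _; rewrite (@le_trans _ _ (`|C| * lorentz x ^+ m))//.
    by rewrite ler_wpM2r// ler_norm.
  by rewrite lerDl !mulr_ge0// exprn_ge0.
apply: le_trans (hB x) _; rewrite (@le_trans _ _ (B * 2 ^+ m * lorentz x ^+ m))//.
  rewrite -mulrA ler_peMr// -exprMn exprn_ege1//.
  rewrite ler_pdivlMr ?ltr_pwDl ?sqr_ge0// mul1r [leRHS](_ : _ = 1 + 1)// lerD2l.
  by rewrite -real_normK ?num_real// exprn_ile1// ltW.
by rewrite lerDr mulr_ge0.
Qed.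

Lemma derivatives_shift F : derivatives F -> derivatives (fun n => F n.+1).
Proof. by move=> [rF hF]; split => [n|n x]; [exact: rF|exact: hF]. Qed.

Lemma odd_at0 (f : R -> R) : (forall x, f (- x) = - f x) -> f 0 = 0.
Proof. by move=> /(_ 0); rewrite oppr0 => h; lra. Qed.

Lemma derive_even_odd (f f' : R -> R) : (forall x, is_derive x 1 f (f' x)) ->
  (forall x, f (- x) = f x) -> forall x, f' (- x) = - f' x.
Proof.
move=> df ef x.
have dN : is_derive x 1 (fun y => f (- y)) (- f' (- x)).
  have h : is_derive x 1 (fun y => - y : R) (- 1).
    by apply: is_derive_eq (is_derive_opp (is_derive_var x)) _.
  by apply: is_derive_eq (is_derive_chain (df (- x)) h) _; rewrite mulrN1.
have fE : (fun y => f (- y)) = f by apply/funext.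
rewrite fE in dN; have [_ h1] := dN; have [_ h2] := df x.
by rewrite -h2 h1 opprK.
Qed.

Lemma divx_even F x : derivatives F -> (forall x, F 0%N (- x) = - F 0%N x) ->
  divx F 0 (- x) = divx F 0 x.
Proof.
move=> dF oF; have F00 := odd_at0 oF.
have [->|x0] := eqVneq x 0; first by rewrite oppr0.
apply: (mulfI x0); rewrite -(divxE x dF F00) -[LHS]opprK -mulNr.
by rewrite -(divxE (- x) dF F00) oF opprK.
Qed.

Fixpoint divx_iter F j : nat -> R -> R :=
  if j is j'.+1 then divx (fun n => divx_iter F j' n.+1) else divx F.

(** Divide by x, differentiate, divide by x again: a quotient is even, so its
derivative is odd and the next division is allowed. *)
Lemma odd_chain F : derivatives F -> (forall x, F 0%N (- x) = - F 0%N x) ->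
  exists u, chain u /\ forall x, F 0%N x = x * u 0%N x.
Proof.
move=> dF oF.
have step G : derivatives G -> (forall x, G 0%N (- x) = G 0%N x) ->
    [/\ derivatives (divx (fun n => G n.+1)),
      forall x, divx (fun n => G n.+1) 0 (- x) = divx (fun n => G n.+1) 0 x &
      forall x, G 1%N x = x * divx (fun n => G n.+1) 0 x].
  move=> dG eG; have dG1 := derivatives_shift dG.
  have oG : forall x, G 1%N (- x) = - G 1%N x.
    by apply: derive_even_odd eG => x; case: dG.
  have G10 := odd_at0 oG.
  split; first exact: derivatives_divx.
    by move=> x; exact: divx_even.
  by move=> x; exact: (divxE x dG1).
have F00 := odd_at0 oF.
have H j : derivatives (divx_iter F j) /\
    forall x, divx_iter F j 0 (- x) = divx_iter F j 0 x.
  elim: j => [|j [dj ej]] /=.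
    by split; [exact: derivatives_divx|move=> x; exact: divx_even].
  by have [] := step _ dj ej.
exists (fun j => divx_iter F j 0); split; last by move=> x; exact: divxE.
split=> [j|j x|j x].
- by case: (H j) => -[].
- have [dj ej] := H j; have [_ _ h] := step _ dj ej.
  by rewrite -(h x); case: dj.
- by case: (H j).
Qed.

End division_by_x.

(** * The formula for real functions *)

Section transforms.
Context {R : realType}.
Implicit Types (g : R -> R) (t x : R).

Lemma integralT_odd g : tame g -> (forall x, g (- x) = - g x) -> integralT g = 0.
Proof.
move=> tg og; have [cg _] := tg.
apply: (cvg_unique _ (cvg_integral_itv tg)) => //.
rewrite (_ : (fun n => _) = (fun=> 0)); first exact: cvg_cst.
apply/funext => n; set J := (X in X = _).
have cn : {within `[- n%:R, n%:R], continuous g} by exact: continuous_subspaceT.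
have nn : - n%:R <= n%:R :> R by rewrite ge0_cp.
have h := @integration_by_substitution_oppr R g (- n%:R) n%:R nn.
rewrite opprK in h.
have : J = - J.
  rewrite /J -[RHS]mulN1r -RintegralZl//; last exact: integrable_itv.
  rewrite [LHS]/Rintegral h//.
  by congr fine; apply: eq_integral => x _; rewrite /= og mulN1r.
by lra.
Qed.

Definition sinT g t := integralT (fun x => g x * sin (2 * pi * t * x)).
Definition cosT g t := integralT (fun x => g x * cos (2 * pi * t * x)).

Lemma is_derive_sinT g t : rapid g ->
  is_derive t 1 (sinT g) (cosT (fun x => 2 * pi * x * g x) t).
Proof.
move=> rg; have rx : rapid (fun x => 2 * pi * x * g x).
  apply: rapidMl => //; apply: moderateM; first exact: moderate_cst.
  exact: moderate_id.
apply: (@is_derive_integralT _ (fun t x => g x * sin (2 * pi * t * x))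
  (fun t x => 2 * pi * x * g x * cos (2 * pi * t * x))).
- by move=> s; apply/rapid_tame/rapidM => //; exact: moderate_sin.
- move=> s x; have h := is_derive_scale (is_derive_sin (2 * pi * x * s)).
  have e := is_derive_mul (is_derive_const (g x) s) h.
  rewrite (_ : (fun y : R => _) = (fun y => g x * sin (2 * pi * x * y))); last first.
    by apply/funext => y; congr (_ * sin _); ring.
  apply: is_derive_eq e _; rewrite (_ : 2 * pi * x * s = 2 * pi * s * x); last by ring.
  by move: (cos _) (sin _) => a b; ring.
- move=> a; have [C hC] := rx.2 1%N; exists C => s x _.
  by rewrite normrM; apply: le_trans (hC x); rewrite ler_piMr// cos_max.
Qed.

Lemma is_derive_cosT g t : rapid g ->
  is_derive t 1 (cosT g) (- sinT (fun x => 2 * pi * x * g x) t).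
Proof.
move=> rg; have rx : rapid (fun x => 2 * pi * x * g x).
  apply: rapidMl => //; apply: moderateM; first exact: moderate_cst.
  exact: moderate_id.
rewrite -integralTN; last by apply/rapid_tame/rapidM => //; exact: moderate_sin.
apply: (@is_derive_integralT _ (fun t x => g x * cos (2 * pi * t * x))
  (fun t x => - (2 * pi * x * g x * sin (2 * pi * t * x)))).
- by move=> s; apply/rapid_tame/rapidM => //; exact: moderate_cos.
- move=> s x; have h := is_derive_scale (is_derive_cos (2 * pi * x * s)).
  have e := is_derive_mul (is_derive_const (g x) s) h.
  rewrite (_ : (fun y : R => _) = (fun y => g x * cos (2 * pi * x * y))); last first.
    by apply/funext => y; congr (_ * cos _); ring.
  apply: is_derive_eq e _; rewrite (_ : 2 * pi * x * s = 2 * pi * s * x); last by ring.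
  by move: (cos _) (sin _) => a b; ring.
- move=> a; have [C hC] := rx.2 1%N; exists C => s x _.
  by rewrite normrN normrM; apply: le_trans (hC x); rewrite ler_piMr// sin_max.
Qed.

End transforms.

Section real_formula.
Context {R : realType}.
Implicit Types (F : nat -> R -> R) (t x : R).

Lemma powR_three_halves n : (n%:R : R) `^ (3 / 2) = Num.sqrt n%:R ^+ 3.
Proof.
by rewrite -powR12_sqrt// (_ : 3 / 2 = 2^-1 * 3%:R)// ?powRrM ?powR_mulrn ?powR_ge0// mulrC.
Qed.

Lemma rsq5_rapid_le g : rapid g ->
  exists C, forall n, `|(rsq 5 n)%:R * g (Num.sqrt n%:R : R)| <= C / n.+1%:R ^+ 2.
Proof.
move=> [_ /(_ 7)[C hC]]; exists (2 ^+ 5 * C) => n.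
have N0 : 0 < n.+1%:R :> R by [].
have r5 : (rsq 5 n)%:R <= (2 * n.+1%:R) ^+ 5 :> R.
  rewrite -[2 : R]/(2%:R) -natrM -natrX ler_nat (leq_trans (rsq_le _ _))//.
  by rewrite leq_exp2r//; lia.
rewrite normrM ger0_norm//; apply: le_trans (ler_pM _ _ r5 (hC _)) _ => //.
rewrite lorentzV sqr_sqrtr// addrC natr1.
by rewrite le_eqVlt; apply/orP; left; apply/eqP; field.
Qed.

(** The two series converge separately, the first one by decay, the second one as
the difference of the first and of the convergent series of sphere_term. *)
Theorem real_summation_formula F : derivatives F ->
  (forall x, F 0%N (- x) = - F 0%N x) ->
  let f := F 0%N in let xf g := fun x => 2 * pi * x * g x in
  exists s1 s2,
  [/\ \sum_(1 <= n < N) (rsq 5 n)%:R / Num.sqrt n%:R * f (Num.sqrt n%:R)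
        @[N --> \oo] --> s1,
      \sum_(1 <= n < N) (rsq 5 n)%:R / (n%:R : R) `^ (3 / 2) *
         (sinT f (Num.sqrt n%:R) - Num.sqrt n%:R * cosT (xf f) (Num.sqrt n%:R))
        @[N --> \oo] --> s2 &
      F 1%N 0 + s1 = (6 * pi)^-1 * cosT (xf (xf (xf f))) 0 + (2 * pi)^-1 * s2].
Proof.
move=> dF oF f xf; have [u [cu fu]] := odd_chain dF oF; have [ru du eu] := cu.
have [rF hF] := dF; have pi0 := @pi_gt0 R.
have F10 : F 1%N 0 = u 0%N 0.
  have [_ <-] := hF 0%N 0.
  have -> : F 0%N = (fun x => x * u 0%N x) by apply/funext.
  have [_ ->] := is_derive_mul (is_derive_var 0) (du 0%N 0).
  by rewrite mul1r !mul0r addr0.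
pose xi n : R := Num.sqrt n%:R.
pose a n := (rsq 5 n)%:R / xi n * f (xi n).
pose b n := (rsq 5 n)%:R / (n%:R : R) `^ (3 / 2) *
  (sinT f (xi n) - xi n * cosT (xf f) (xi n)).
have xi0 n : 0 < xi n.+1 by rewrite sqrtr_gt0.
have rxf : rapid (xf f).
  apply: (@rapidMl _ (fun x => 2 * pi * x)); last exact: rF.
  by apply: moderateM; [exact: moderate_cst|exact: moderate_id].
have termE n : sphere_term (u 0%N) n.+1 = a n.+1 - (2 * pi)^-1 * b n.+1.
  rewrite /sphere_term /a /b powR_three_halves -/(xi n.+1).
  have -> : integralT (fun x => x * u 0%N x * bessel 1 (2 * pi * xi n.+1 * x)) =
      sinT f (xi n.+1) - xi n.+1 * cosT (xf f) (xi n.+1).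
    rewrite -mulNr -integralTZ; last first.
      by apply/rapid_tame/rapidM => //; exact: moderate_cos.
    rewrite -integralTD.
    - by apply: eq_integralT => x; rewrite /xf /f fu /=; ring.
    - by apply/rapid_tame/rapidM; [exact: rF|exact: moderate_sin].
    - by apply: tameZ; apply/rapid_tame/rapidM => //; exact: moderate_cos.
  move: (sinT f (xi n.+1) - _) => D; rewrite /f fu; move: (xi0 n); move: (xi n.+1) => y y0.
  move: (u 0%N y) ((rsq 5 n.+1)%:R : R) pi pi0 => v r p p0.
  by field; rewrite !gt_eqF.
have aE n : a n.+1 = (rsq 5 n.+1)%:R * u 0%N (xi n.+1).
  by rewrite /a /f fu mulrA divfK// gt_eqF.
have [C hC] := rsq5_rapid_le (ru 0%N).
have cva : cvgn (series (fun n => (rsq 5 n)%:R * u 0%N (xi n))).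
  exact: is_cvg_series_le_inv_sqr hC.
pose l := limn (series (fun n => (rsq 5 n)%:R * u 0%N (xi n))).
pose a0 := (rsq 5 0)%:R * u 0%N (xi 0%N).
have h1 : \sum_(1 <= n < N) a n @[N --> \oo] --> l - a0.
  have hh : series (fun n => (rsq 5 n)%:R * u 0%N (xi n)) N - a0 @[N --> \oo] --> l - a0.
    by apply: cvgB => //; exact: cvg_cst.
  apply: cvg_trans hh; apply: near_eq_cvg; near=> N.
  have N0 : (0 < N)%N by near: N; exact: nbhs_infty_gt.
  rewrite /= /series/= big_ltn// -/a0 addrAC subrr add0r.
  by apply: eq_big_nat => -[|n] //= _; rewrite aE.
have h0 := sphere_series_chain cu.
pose t0 := sphere_term (u 0%N) 0.
pose s2 := 2 * pi * (l - a0 + t0).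
have h2 : \sum_(1 <= n < N) b n @[N --> \oo] --> s2.
  have hh : 2 * pi * (\sum_(1 <= n < N) a n - (series (sphere_term (u 0%N)) N - t0))
      @[N --> \oo] --> s2.
    rewrite /s2 -[X in l - a0 + X]opprK -[X in _ - X]sub0r.
    apply: cvgM; first exact: cvg_cst.
    by apply: cvgB => //; apply: cvgB => //; exact: cvg_cst.
  apply: cvg_trans hh; apply: near_eq_cvg; near=> N.
  have N0 : (0 < N)%N by near: N; exact: nbhs_infty_gt.
  rewrite /= /series/= [in X in _ - X]big_ltn// [_ + \sum_(_ <= _ < _) _]addrC addrK.
  rewrite -sumrB mulr_sumr; apply: eq_big_nat => -[//|n] _.
  rewrite termE; move: pi pi0 => p p0; field; rewrite gt_eqF//.
exists (l - a0), s2; split => //.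
rewrite F10 /s2 mulrA mulVf ?mul1r; last by rewrite gt_eqF// mulr_gt0.
rewrite /t0 /sphere_term (_ : cosT _ 0 =
    integralT (fun x => (2 * pi * x) ^+ 3 * (x * u 0%N x))).
  by ring.
apply: eq_integralT => x; rewrite mulr0 mul0r cos0 mulr1 /xf /f fu; ring.
Unshelve. all: end_near. Qed.

End real_formula.

(** * Real and imaginary parts *)

Section complex_parts.
Context {R : realType}.
Implicit Types (f : R -> R[i]).

Lemma normc_ge_Re (z : R[i]) : `|complex.Re z| <= Normc.normc z.
Proof. by case: z => a b /=; rewrite -sqrtr_sqr ler_wsqrtr// lerDl sqr_ge0. Qed.

Lemma normc_ge_Im (z : R[i]) : `|complex.Im z| <= Normc.normc z.
Proof. by case: z => a b /=; rewrite -sqrtr_sqr ler_wsqrtr// lerDr sqr_ge0. Qed.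

Lemma normc_le (a b : R) : Normc.normc (a +i* b) <= `|a| + `|b|.
Proof.
rewrite /= -[leRHS]ger0_norm ?addr_ge0// -sqrtr_sqr ler_wsqrtr//.
rewrite sqrrD !real_normK ?num_real// lerD2r lerDl.
by rewrite mulrn_wge0// mulr_ge0.
Qed.

Lemma csum_from1_parts (a b : nat -> R) (s t : R) :
  \sum_(1 <= n < N) a n @[N --> \oo] --> s ->
  \sum_(1 <= n < N) b n @[N --> \oo] --> t ->
  csum_from1 (fun n => a n +i* b n) (s +i* t).
Proof.
move=> ha hb; rewrite /csum_from1.
have sumE N : \sum_(1 <= n < N) (a n +i* b n) =
    (\sum_(1 <= n < N) a n) +i* (\sum_(1 <= n < N) b n).
  by elim/big_rec3: _ => // n x y z _ ->.
have h : `|\sum_(1 <= n < N) a n - s| + `|\sum_(1 <= n < N) b n - t|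
    @[N --> \oo] --> (0 : R).
  rewrite -[X in _ --> X](addr0 0).
  apply: cvgD; rewrite -[X in _ --> X](@normr0 R R);
    by apply: cvg_norm; exact/subr_cvg0.
apply: (squeeze_cvgr _ (cvg_cst 0) h); apply: nearW => N.
by rewrite (le_trans (normr_ge0 _) (normc_ge_Re _))/= sumE; exact: normc_le.
Qed.

(** By (1 + y) ^ m <= 2 ^ m (1 + y ^ m) at y = x ^ 2. *)
Lemma rapid_of_bounds (g : R -> R) : continuous g ->
  (forall k, exists M, forall x, `|x| ^+ k * `|g x| <= M) -> rapid g.
Proof.
move=> cg gM; split => // m.
have [M hM] := gM 0%N; have [N hN] := gM m.*2.
exists (2 ^+ m * (M + N)) => x.
rewrite lorentzV ler_pdivlMr ?exprn_gt0 ?ltr_pwDl ?sqr_ge0//.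
have h : (1 + x ^+ 2) ^+ m <= 2 ^+ m * (1 + `|x| ^+ m.*2).
  have y0 : 0 <= x ^+ 2 by exact: sqr_ge0.
  have -> : `|x| ^+ m.*2 = (x ^+ 2) ^+ m by rewrite -mul2n exprM real_normK// num_real.
  move: (x ^+ 2) y0 => y y0.
  have [y1|y1] := leP y 1.
    apply: (@le_trans _ _ (2 ^+ m * 1)).
      rewrite mulr1; apply: lerXn2r; rewrite ?nnegrE ?addr_ge0//.
      by rewrite [leRHS](_ : _ = 1 + 1)// lerD2l.
    by rewrite ler_wpM2l ?exprn_ge0// lerDl exprn_ge0.
  apply: (@le_trans _ _ (2 ^+ m * y ^+ m)).
    rewrite -exprMn; apply: lerXn2r; rewrite ?nnegrE ?addr_ge0 ?mulr_ge0//.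
    by lra.
  by rewrite ler_wpM2l ?exprn_ge0// lerDr.
apply: le_trans (ler_wpM2l _ h) _; first by [].
rewrite mulrCA ler_wpM2l ?exprn_ge0// mulrDr mulr1 lerD//.
  by have := hM x; rewrite expr0 mul1r.
by rewrite mulrC.
Qed.

Lemma schwartz_parts f : schwartz f ->
  derivatives (fun n => derive1n n (fun x => complex.Re (f x))) /\
  derivatives (fun n => derive1n n (fun x => complex.Im (f x))).
Proof.
move=> [sm dec].
have der (g : R -> R) n : (forall x : R, derivable (derive1n n g) x 1) ->
    forall x : R, is_derive x 1 (derive1n n g) (derive1n n.+1 g x).
  by move=> dg x; rewrite derive1nS derive1E; exact/derivableP/dg.
have d1 n x := der _ _ (fun y => (sm n y).1) x.
have d2 n x := der _ _ (fun y => (sm n y).2) x.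
split; split=> // n; apply: rapid_of_bounds.
- exact: is_derive_continuous (d1 n).
- move=> k; have [M hM] := dec k n; exists M => x; apply: le_trans (hM x).
  by rewrite ler_wpM2l ?exprn_ge0//; exact: (normc_ge_Re (cderiven n f x)).
- exact: is_derive_continuous (d2 n).
- move=> k; have [M hM] := dec k n; exists M => x; apply: le_trans (hM x).
  by rewrite ler_wpM2l ?exprn_ge0//; exact: (normc_ge_Im (cderiven n f x)).
Qed.

Lemma derive1n_sinT (g : R -> R) : rapid g ->
  derive1n 1 (sinT g) = cosT (fun x => 2 * pi * x * g x) /\
  derive1n 3 (sinT g) = (fun t => - cosT (fun x => 2 * pi * x *
    (2 * pi * x * (2 * pi * x * g x))) t).
Proof.
have rx (h : R -> R) : rapid h -> rapid (fun x => 2 * pi * x * h x).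
  move=> rh; apply: (@rapidMl _ (fun x => 2 * pi * x)) => //.
  by apply: moderateM; [exact: moderate_cst|exact: moderate_id].
move=> rg.
have e1 : derive1 (sinT g) = cosT (fun x => 2 * pi * x * g x).
  apply/funext => t; rewrite derive1E.
  by have := is_derive_sinT t rg => -[].
have e2 : derive1 (cosT (fun x => 2 * pi * x * g x)) =
    (fun t => - sinT (fun x => 2 * pi * x * (2 * pi * x * g x)) t).
  apply/funext => t; rewrite derive1E.
  by have := is_derive_cosT t (rx _ rg) => -[].
split; first exact: e1.
rewrite /derive1n /= e1 e2; apply/funext => t; rewrite derive1E.
by have := is_derive_opp (is_derive_sinT t (rx _ (rx _ rg))) => -[].
Qed.

Lemma cosTN (g : R -> R) t : rapid g -> cosT (fun x => - g x) t = - cosT g t.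
Proof.
move=> rg; rewrite -integralTN; last by apply/rapid_tame/rapidM => //; exact: moderate_cos.
by apply: eq_integralT => x; rewrite mulNr.
Qed.

Lemma sinTN (g : R -> R) t : rapid g -> sinT (fun x => - g x) t = - sinT g t.
Proof.
move=> rg; rewrite -integralTN; last by apply/rapid_tame/rapidM => //; exact: moderate_sin.
by apply: eq_integralT => x; rewrite mulNr.
Qed.

(** The cosine parts vanish by oddness, and the factor - i exchanges real and
imaginary parts. *)
Lemma fourier_odd f (F G : nat -> R -> R) : derivatives F -> derivatives G ->
  (forall x, f x = F 0%N x +i* G 0%N x) ->
  (forall x, F 0%N (- x) = - F 0%N x) -> (forall x, G 0%N (- x) = - G 0%N x) ->
  forall t, fourier f t = sinT (G 0%N) t +i* (- sinT (F 0%N) t).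
Proof.
move=> dF dG fE oF oG t.
have tc (H : nat -> R -> R) : derivatives H -> tame (fun x => H 0%N x * cos (2 * pi * t * x)).
  by move=> [rH _]; apply/rapid_tame/rapidM => //; exact: moderate_cos.
have ts (H : nat -> R -> R) : derivatives H -> tame (fun x => H 0%N x * sin (2 * pi * t * x)).
  by move=> [rH _]; apply/rapid_tame/rapidM => //; exact: moderate_sin.
have c0 (H : nat -> R -> R) : derivatives H -> (forall x, H 0%N (- x) = - H 0%N x) ->
    integralT (fun x => H 0%N x * cos (2 * pi * t * x)) = 0.
  move=> dH oH; apply: integralT_odd; first exact: tc.
  by move=> x; rewrite oH mulrN cosN mulNr.
rewrite /fourier /cintegral; congr (_ +i* _).
  rewrite -[RHS]add0r -(c0 F dF oF) -integralTD; [|exact: tc|exact: ts].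
  apply: eq_integralT => x; rewrite fE /expi/= cosN sinN.
  by ring.
rewrite -[RHS]add0r -(c0 G dG oG) -integralTN; last exact: ts.
rewrite -integralTD; [|exact: tc|exact/tameN/ts].
apply: eq_integralT => x; rewrite fE /expi/= cosN sinN.
by ring.
Qed.

End complex_parts.

Theorem theorem2p1 (R : realType) (phi psi : R -> R[i])
    (phi_schwartz : schwartz phi)
    (phi_odd : forall x : R, phi (- x) = - phi x)
    (psiE : psi = fourier phi) :
  exists S1 S2 : R[i],
    [/\ csum_from1 (fun n : nat =>
          ((rsq 5 n)%:R / Num.sqrt (n%:R : R))%:C * phi (Num.sqrt n%:R)) S1,
        csum_from1 (fun n : nat =>
          ((rsq 5 n)%:R / (n%:R : R) `^ (3 / 2))%:C *
          (psi (Num.sqrt n%:R) -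
           (Num.sqrt n%:R)%:C * cderiven 1 psi (Num.sqrt n%:R))) S2
      & cderiven 1 phi 0 + S1 =
          - ('i%C / (6 * pi)%:C) * cderiven 3 psi 0 +
          'i%C / (2 * pi)%:C * S2].
Proof.
have [dF dG] := schwartz_parts phi_schwartz.
set F := (fun n => derive1n n (fun x => complex.Re (phi x))) in dF.
set G := (fun n => derive1n n (fun x => complex.Im (phi x))) in dG.
have phiE x : phi x = F 0%N x +i* G 0%N x by rewrite /F /G !derive1n0; case: (phi x).
have oF x : F 0%N (- x) = - F 0%N x.
  by rewrite /F !derive1n0 phi_odd; case: (phi x).
have oG x : G 0%N (- x) = - G 0%N x.
  by rewrite /G !derive1n0 phi_odd; case: (phi x).
have rF : rapid (F 0%N) by case: dF.
have rG : rapid (G 0%N) by case: dG.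
have rF' : rapid (fun x => - F 0%N x).
  by apply: eq_rapid (rapidZ (-1) rF) => x; rewrite mulN1r.
pose xf (g : R -> R) := fun x => 2 * pi * x * g x.
have rx (h : R -> R) : rapid h -> rapid (xf h).
  move=> rh; apply: (@rapidMl _ (fun x => 2 * pi * x)) => //.
  by apply: moderateM; [exact: moderate_cst|exact: moderate_id].
have xfN h : xf (fun x => - h x) = fun x => - xf h x.
  by apply/funext => x; rewrite /xf mulrN.
have psi_val t : psi t = sinT (G 0%N) t +i* sinT (fun x => - F 0%N x) t.
  by rewrite psiE (fourier_odd dF dG phiE oF oG) sinTN.
have psiRe : (fun t => complex.Re (psi t)) = sinT (G 0%N).
  by apply/funext => t; rewrite psi_val.
have psiIm : (fun t => complex.Im (psi t)) = sinT (fun x => - F 0%N x).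
  by apply/funext => t; rewrite psi_val.
have [dG1 dG3] := derive1n_sinT rG; have [dF1 dF3] := derive1n_sinT rF'.
have psi1 t : cderiven 1 psi t = cosT (xf (G 0%N)) t +i* - cosT (xf (F 0%N)) t.
  rewrite /cderiven psiRe psiIm dG1 dF1; congr (_ +i* _).
  by rewrite -/(xf _) xfN cosTN//; exact: rx.
have psi3 : cderiven 3 psi 0 =
    - cosT (xf (xf (xf (G 0%N)))) 0 +i* cosT (xf (xf (xf (F 0%N)))) 0.
  rewrite /cderiven psiRe psiIm dG3 dF3; congr (_ +i* _).
  rewrite (_ : (fun x => _) = (fun x => - xf (xf (xf (F 0%N))) x)); last first.
    by apply/funext => x; rewrite /xf !mulrN.
  by rewrite cosTN ?opprK//; exact: (rx _ (rx _ (rx _ rF))).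
have [s1 [s2 [hs1 hs2 hs]]] := real_summation_formula dF oF.
have [t1 [t2 [ht1 ht2 ht]]] := real_summation_formula dG oG.
exists (s1 +i* t1), (t2 +i* - s2); split.
- have := csum_from1_parts hs1 ht1; congr csum_from1.
  apply/funext => n; rewrite phiE.
  by apply/eqP; rewrite eq_complex /=; apply/andP; split; apply/eqP; ring.
- have hs2N : \sum_(1 <= n < N) - ((rsq 5 n)%:R / (n%:R : R) `^ (3 / 2) *
      (sinT (F 0%N) (Num.sqrt n%:R) - Num.sqrt n%:R * cosT (xf (F 0%N)) (Num.sqrt n%:R)))
      @[N --> \oo] --> - s2.
    by under eq_fun do rewrite sumrN; apply: cvgN.
  have := csum_from1_parts ht2 hs2N; congr csum_from1.
  apply/funext => n; rewrite psi_val psi1 sinTN//.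
  by apply/eqP; rewrite eq_complex /=; apply/andP; split; apply/eqP; ring.
- have iE (r : R) : 'i%C / r%:C = 0 +i* r^-1.
    rewrite -fmorphV.
    by apply/eqP; rewrite eq_complex /=; apply/andP; split; apply/eqP; ring.
  have phi1 : cderiven 1 phi 0 = F 1%N 0 +i* G 1%N 0 by [].
  rewrite !iE psi3 phi1 -/(xf _).
  apply/eqP; rewrite eq_complex /= hs ht -!/(xf _).
  by apply/andP; split; apply/eqP; ring.
Qed.
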